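(* Let $\Bbbk$ be a commutative ring with $1$, and let $R\to A$ be a map of $\Bbbk$-algebras such that $A$ is finitely generated and projective as a left $R$-module. Assume further that $A$ is finitely generated and projective as a right $R$-module, and that the cochain complex $Q_\bullet$ (universal differential complex of $R\to A$, see context) is exact and splits, in the sense that for every $m\ge1$ one has $Q_m=\partial Q_{m-1}\oplus\overline{Q}_m=\mathrm{Ker}(\partial_m)\oplus\overline{Q}_m$ as right $R$-modules, for some right $R$-module $\overline{Q}_m$. Let $C=R^{(\mathbb{N})}\oplus R^{(\mathbb{N})}$ be the ring with enough orthogonal idempotents described in the context and $Q=\bigoplus_{n\ge0}Q_n$ with its right unital $C$-module structure. Then $Q_C$ is a flat module. In particular, $Q_C$ is faithfully flat in either one of the following cases: (1) $A=R\oplus Rt$ ($t^2=0$) is the trivial extension of $R$. (2) $\Bbbk$ is a field and $R$ is a division $\Bbbk$-algebra.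
   Context: Conventions: $R$ and $A$ are $\Bbbk$-algebras with identity, and $R\to A$ preserves identities. The trivial extension $A=R\oplus Rt$ is the $R$-ring free as left (and right) $R$-module on $1$ and $t$, with $rt=tr$ for $r\in R$ and $t^2=0$. The complex $Q_\bullet$: $K=\ker(A\otimes_RA\to A)$ (multiplication), $\partial:A\to K$, $\partial a=1\otimes_Ra-a\otimes_R1$; $Q_0=R$, $Q_1=A$, $Q_n=K\otimes_A\cdots\otimes_AK$ ($n-1$ factors) for $n\ge2$; $\partial_0:R\to A$ is the unit map, $\partial_1=\partial$, and for $n\ge2$, $\partial_n:Q_n\to Q_{n+1}$ sends $a_0\partial a_1\otimes_A\cdots\otimes_A\partial a_{n-1}$ to $\partial a_0\otimes_A\partial a_1\otimes_A\cdots\otimes_A\partial a_{n-1}$. The complex is $Q_0\to Q_1\to Q_2\to\cdots$ (exactness at $Q_0$ means $\partial_0$ is injective); all maps are $R$-bilinear. Here $\partial Q_{m-1}$ denotes the image of $\partial_{m-1}$ in $Q_m$. The ring $C$ (with enough orthogonal idempotents $h_n$, not necessarily with an identity): free left $R$-module on $\{h_n,u_n\}_{n\in\mathbb{N}}$, the generators commuting with $R$, with $h_nh_m=\delta_{n,m}h_n$, $u_nu_m=0$, $u_nh_{n+1}=u_n=h_nu_n$ (all other products of generators zero). A left module $M$ is unital if $M=\bigoplus_nh_nM$; right unital modules are defined similarly. $Q$ is a right unital $C$-module: $q\,(rh_n)=q_nr$ and $q\,(ru_n)=\partial_n(q_n)r$, where $q_n$ is the component of $q$ in $Q_n$. $Q_C$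 is flat if $Q\otimes_C-$ is exact on unital left $C$-modules, and faithfully flat if this functor is moreover faithful.
   Formalization: Case (2) additionally assumes that R→A is not an isomorphism: for A=R a division algebra all hypotheses hold, but Q_n=0 for n≥2, so Q⊗_C− kills the nonzero module R concentrated in degree 2 and Q_C is not faithfully flat. *)

(* Defs.v *)
From HB Require Import structures.
From mathcomp Require Import all_boot all_algebra.
From mathcomp Require Import boolp.
From mathcomp Require Import freeg.

Set Implicit Arguments.
Unset Strict Implicit.
Unset Printing Implicit Defensive.

Import GRing.Theory Quotient.

Local Open Scope ring_scope.
Local Open Scope quotient_scope.

(** A right module over [R] is a left module over the converse ring [R^c]. *)
Definition fin_gen (R : pzRingType) (M : lmodType R) : Prop :=
  exists (n : nat) (e : 'I_n -> M),
    forall x : M, exists c : 'I_n -> R, x = \sum_(i < n) c i *: e i.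

Definition projective (R : pzRingType) (M : lmodType R) : Prop :=
  forall (N P : lmodType R) (g : {linear N -> P}) (h : {linear M -> P}),
    (forall y, exists x, g x = y) -> exists l : {linear M -> N}, g \o l =1 h.

Definition division_ring (D : pzRingType) : Prop :=
  (1 : D) <> 0 /\ forall x : D, x <> 0 -> exists2 y : D, x * y = 1 & y * x = 1.

(** The scalars [S] act on the right of [M] by [ra] and on the left of [N] by
[la]; [S] is only a type, so that one construction covers tensor products over
unital rings and over rings with enough idempotents. *)
Section Tensor.
Variables (S : Type) (M N : zmodType) (ra : M -> S -> M) (la : S -> N -> N).

Inductive tensor_rel : {freeg (M * N)} -> Prop :=
| tensor_rel0 : tensor_rel 0
| tensor_relB x y : tensor_rel x -> tensor_rel y -> tensor_rel (x - y)
| tensor_relDl m m' n :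
    tensor_rel (<< (m + m', n) >> - << (m, n) >> - << (m', n) >>)
| tensor_relDr m n n' :
    tensor_rel (<< (m, n + n') >> - << (m, n) >> - << (m, n') >>)
| tensor_relA m s n : tensor_rel (<< (ra m s, n) >> - << (m, la s n) >>).

Definition tensor_ker (x : {freeg (M * N)}) : bool := `[< tensor_rel x >].

Lemma tensor_ker_zmod_closed : zmod_closed tensor_ker.
Proof.
split; first exact/asboolP/tensor_rel0.
by move=> x y /asboolP hx /asboolP hy; apply/asboolP/tensor_relB.
Qed.

HB.instance Definition _ :=
  GRing.isZmodClosed.Build {freeg (M * N)} tensor_ker tensor_ker_zmod_closed.

Definition tensor_sub : zmodClosed {freeg (M * N)} :=
  GRing.ZmodClosed.clone _ tensor_ker _.

Definition tensor : Type := Quotient.quot tensor_sub.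
HB.instance Definition _ := GRing.Zmodule.on tensor.

Definition tens_pi (x : {freeg (M * N)}) : tensor :=
  \pi_(Quotient.quot tensor_sub) x.

Definition tens (m : M) (n : N) : tensor := tens_pi << (m, n) >>.

Lemma tens_piB x y : tens_pi (x - y) = tens_pi x - tens_pi y.
Proof. exact: (raddfB (\pi_(Quotient.quot tensor_sub))). Qed.

Lemma tens_pi_eq x y : (tens_pi x = tens_pi y) <-> tensor_rel (x - y).
Proof.
have e : (tens_pi x == tens_pi y) = tensor_ker (x - y).
  by rewrite -[LHS]Quotient.idealrBE.
by split=> [/eqP|h]; [rewrite e => /asboolP | apply/eqP; rewrite e; apply/asboolP].
Qed.

Lemma tens_pi0 x : tensor_rel x -> tens_pi x = 0.
Proof.
move=> h; rewrite -[RHS](subrr (tens_pi 0)) -tens_piB subr0.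
by apply/tens_pi_eq; rewrite subr0.
Qed.

Lemma tensDl m m' n : tens (m + m') n = tens m n + tens m' n.
Proof.
have := tens_pi0 (tensor_relDl m m' n); rewrite !tens_piB => /eqP.
by rewrite -addrA -opprD subr_eq0 => /eqP.
Qed.

Lemma tensDr m n n' : tens m (n + n') = tens m n + tens m n'.
Proof.
have := tens_pi0 (tensor_relDr m n n'); rewrite !tens_piB => /eqP.
by rewrite -addrA -opprD subr_eq0 => /eqP.
Qed.

Lemma tensA m s n : tens (ra m s) n = tens m (la s n).
Proof. by apply/tens_pi_eq; apply: tensor_relA. Qed.

Lemma tens_ind (P : tensor -> Prop) :
    (forall x y, P x -> P y -> P (x - y)) -> (forall m n, P (tens m n)) ->
  forall x, P x.
Proof.
move=> PB Pt x.
have P0 : P 0 by rewrite -(subrr (tens 0 0)); apply: PB.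
have PD y z : P y -> P z -> P (y + z).
  by move=> hy hz; rewrite -[z]opprK; apply: (PB) => //; rewrite -sub0r; apply: (PB).
rewrite -[x](@reprK _ (Quotient.quot tensor_sub)) -/(tens_pi _).
move: (repr x) => {x} y; rewrite -(freeg_sumE y).
elim: (dom y) => [|z s IH].
  by rewrite big_nil tens_pi0 //; apply: tensor_rel0.
rewrite big_cons; set c := coeff z y.
have PM n w : P w -> P (w *+ n).
  by move=> hw; elim: n => [|n IHn]; rewrite ?mulr0n // mulrS; apply: PD.
have piD a b : tens_pi (a + b) = tens_pi a + tens_pi b.
  exact: (raddfD (\pi_(Quotient.quot tensor_sub))).
rewrite piD; apply: PD IH.
have -> : << c *g z >> = << z >> *~ c :> {freeg (M * N)}.
  by rewrite freegU_mulz intz.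
have piMn a n : tens_pi (a *+ n) = tens_pi a *+ n.
  exact: (raddfMn (\pi_(Quotient.quot tensor_sub))).
have Pz : P (tens_pi << z >>) by case: z {c} => m n; apply: Pt.
case: c => n; rewrite ?pmulrn -?pmulrn ?piMn; first exact: PM.
rewrite NegzE mulrNz -sub0r -pmulrn tens_piB piMn tens_pi0; last exact: tensor_rel0.
by apply: (PB) => //; apply: (PM).
Qed.

(** The map induced by [phi], meaningful when [phi] is balanced. *)
Section Lift.
Variables (Z : zmodType) (phi : M -> N -> Z).

Definition balanced : Prop :=
  [/\ forall m m' n, phi (m + m') n = phi m n + phi m' n,
      forall m n n', phi m (n + n') = phi m n + phi m n'
    & forall m s n, phi (ra m s) n = phi m (la s n)].

Definition tlift (x : tensor) : Z :=
  fglift (fun p : M * N => phi p.1 p.2 : zmodule Z)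
    (repr (x : Quotient.quot tensor_sub)).

Hypothesis phi_bal : balanced.

Let L : {freeg (M * N)} -> zmodule Z :=
  fglift (fun p : M * N => phi p.1 p.2 : zmodule Z).

Let LB x y : L (x - y) = L x - L y.
Proof. exact: lift_is_additive. Qed.

Lemma tlift_rel x : tensor_rel x -> L x = 0.
Proof.
case: phi_bal => hl hr ha.
have LU p : L << p >> = phi p.1 p.2 by rewrite /L liftU scale1r.
elim=> [|y z _ hy _ hz|m m' n|m n n'|m s n].
- by rewrite -(subrr 0) LB subrr.
- by rewrite LB hy hz subr0.
- by rewrite !LB !LU /= hl addrAC -addrA -opprD [X in _ - X]addrC subrr.
- by rewrite !LB !LU /= hr addrAC -addrA -opprD [X in _ - X]addrC subrr.
- by rewrite !LB !LU /= ha subrr.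
Qed.

Lemma tlift_pi x : tlift (tens_pi x) = L x.
Proof.
apply/eqP; rewrite -subr_eq0; apply/eqP; rewrite -[LHS]LB; apply/tlift_rel.
by apply/tens_pi_eq; rewrite /tens_pi reprK.
Qed.

Lemma tliftE m n : tlift (tens m n) = phi m n.
Proof. by rewrite tlift_pi /L liftU scale1r. Qed.

Lemma tlift_is_zmod_morphism : zmod_morphism tlift.
Proof.
move=> x y.
rewrite -[x](@reprK _ (Quotient.quot tensor_sub)) -/(tens_pi _).
rewrite -[y](@reprK _ (Quotient.quot tensor_sub)) -/(tens_pi _).
by rewrite -tens_piB !tlift_pi; apply: LB.
Qed.

Lemma tliftB x y : tlift (x - y) = tlift x - tlift y.
Proof. exact: tlift_is_zmod_morphism. Qed.

Lemma tliftD x y : tlift (x + y) = tlift x + tlift y.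
Proof.
have t0 : tlift 0 = 0 by rewrite -[X in tlift X](subrr 0) tliftB subrr.
by rewrite -{1}[y]opprK tliftB -[- y]sub0r tliftB t0 sub0r opprK.
Qed.

End Lift.
End Tensor.

Arguments tens {S M N} ra la m n.

Section TensTheory.
Variables (S : Type) (M N : zmodType) (ra : M -> S -> M) (la : S -> N -> N).
Implicit Types (m : M) (n : N).
Local Notation "m ⊗ n" := (tens ra la m n) (at level 39).

Lemma tens0l n : 0 ⊗ n = 0.
Proof. by apply: (addrI (0 ⊗ n)); rewrite -tensDl !addr0. Qed.

Lemma tens0r m : m ⊗ 0 = 0.
Proof. by apply: (addrI (m ⊗ 0)); rewrite -tensDr !addr0. Qed.

Lemma tensBl m m' n : (m - m') ⊗ n = m ⊗ n - m' ⊗ n.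
Proof. by apply/eqP; rewrite eq_sym subr_eq -tensDl subrK. Qed.

Lemma tensBr m n n' : m ⊗ (n - n') = m ⊗ n - m ⊗ n'.
Proof. by apply/eqP; rewrite eq_sym subr_eq -tensDr subrK. Qed.

Lemma tens_ext (Z : zmodType) (f g : tensor ra la -> Z) :
    zmod_morphism f -> zmod_morphism g ->
    (forall m n, f (m ⊗ n) = g (m ⊗ n)) -> f =1 g.
Proof. by move=> fB gB e; elim/tens_ind=> // x y hx hy; rewrite fB gB hx hy. Qed.

End TensTheory.

HB.mixin Record Lmodule_isBimodule (A : pzRingType) V of GRing.Lmodule A V := {
  rscale : V -> A -> V;
  rscaleDl : forall v w a, rscale (v + w) a = rscale v a + rscale w a;
  rscaleDr : forall v a b, rscale v (a + b) = rscale v a + rscale v b;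
  rscaleA : forall v a b, rscale (rscale v a) b = rscale v (a * b);
  rscale1 : forall v, rscale v 1 = v;
  rscaleZ : forall a v b, rscale (a *: v) b = a *: rscale v b
}.

#[short(type="bimodType")]
HB.structure Definition Bimodule (A : pzRingType) :=
  {V of GRing.Lmodule A V & Lmodule_isBimodule A V}.

Section BimoduleTheory.
Variables (A : pzRingType) (V : bimodType A).

Lemma rscaleBl (v w : V) (a : A) : rscale (v - w) a = rscale v a - rscale w a.
Proof. by apply/eqP; rewrite eq_sym subr_eq -rscaleDl subrK. Qed.

Lemma rscaleBr (v : V) (a b : A) : rscale v (a - b) = rscale v a - rscale v b.
Proof. by apply/eqP; rewrite eq_sym subr_eq -rscaleDr subrK. Qed.

End BimoduleTheory.

Section BimodTensor.
Variables (A : pzRingType) (M N : bimodType A).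

Definition btensor : Type :=
  tensor (@rscale A M) (fun (a : A) (n : N) => a *: n).
HB.instance Definition _ := GRing.Zmodule.on btensor.

Definition btens (m : M) (n : N) : btensor :=
  tens (@rscale A M) (fun (a : A) (n : N) => a *: n) m n.

Lemma btensDl m m' n : btens (m + m') n = btens m n + btens m' n.
Proof. exact: tensDl. Qed.
Lemma btensDr m n n' : btens m (n + n') = btens m n + btens m n'.
Proof. exact: tensDr. Qed.
Lemma btensBl m m' n : btens (m - m') n = btens m n - btens m' n.
Proof. exact: tensBl. Qed.
Lemma btensBr m n n' : btens m (n - n') = btens m n - btens m n'.
Proof. exact: tensBr. Qed.
Lemma btens0l n : btens 0 n = 0. Proof. exact: tens0l. Qed.
Lemma btens0r m : btens m 0 = 0. Proof. exact: tens0r. Qed.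
Lemma btensA m a n : btens (rscale m a) n = btens m (a *: n).
Proof. exact: (tensA (@rscale A M) (fun (a : A) (n : N) => a *: n)). Qed.

Lemma btens_ext (Z : zmodType) (f g : btensor -> Z) :
    zmod_morphism f -> zmod_morphism g ->
    (forall m n, f (btens m n) = g (btens m n)) -> f =1 g.
Proof. exact: tens_ext. Qed.

Definition btensor_scale (a : A) : btensor -> btensor :=
  tlift (fun m n => btens (a *: m) n).

Definition btensor_rscale (x : btensor) (a : A) : btensor :=
  tlift (fun m n => btens m (rscale n a)) x.

Lemma btensor_scale_bal a : balanced (@rscale A M) (fun (a : A) (n : N) => a *: n)
  (fun m n => btens (a *: m) n).
Proof.
split=> [m m' n|m n n'|m s n]; first by rewrite scalerDr btensDl.
  by rewrite btensDr.
by rewrite -rscaleZ btensA.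
Qed.

Lemma btensor_rscale_bal a : balanced (@rscale A M) (fun (a : A) (n : N) => a *: n)
  (fun m n => btens m (rscale n a)).
Proof.
split=> [m m' n|m n n'|m s n]; first by rewrite btensDl.
  by rewrite rscaleDl btensDr.
by rewrite btensA rscaleZ.
Qed.

Let sB a x y : btensor_scale a (x - y) = btensor_scale a x - btensor_scale a y.
Proof. exact: (tliftB (btensor_scale_bal a)). Qed.
Let sD a x y : btensor_scale a (x + y) = btensor_scale a x + btensor_scale a y.
Proof. exact: (tliftD (btensor_scale_bal a)). Qed.
Let sE a m n : btensor_scale a (btens m n) = btens (a *: m) n.
Proof. exact: (tliftE (btensor_scale_bal a)). Qed.
Let rB x y a :
  btensor_rscale (x - y) a = btensor_rscale x a - btensor_rscale y a.
Proof. exact: (tliftB (btensor_rscale_bal a)). Qed.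
Let rD x y a :
  btensor_rscale (x + y) a = btensor_rscale x a + btensor_rscale y a.
Proof. exact: (tliftD (btensor_rscale_bal a)). Qed.
Let rE m n a : btensor_rscale (btens m n) a = btens m (rscale n a).
Proof. exact: (tliftE (btensor_rscale_bal a)). Qed.

Let subrDD (V : zmodType) (a b c d : V) : a + b - (c + d) = a - c + (b - d).
Proof. by rewrite opprD addrACA. Qed.

Lemma btensor_scalerA a b x :
  btensor_scale a (btensor_scale b x) = btensor_scale (a * b) x.
Proof.
move: x; apply: btens_ext => [x y|x y|m n]; rewrite ?sB //.
by rewrite !sE scalerA.
Qed.

Lemma btensor_scale1r : left_id 1 btensor_scale.
Proof.
by apply: btens_ext => [x y|x y|m n]; rewrite ?sB // sE scale1r.
Qed.

Lemma btensor_scalerDl x : {morph btensor_scale^~ x : a b / a + b}.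
Proof.
move=> a b /=; move: x.
apply: btens_ext => [x y|x y|m n]; rewrite ?sB //; first by rewrite subrDD.
by rewrite !sE scalerDl btensDl.
Qed.

HB.instance Definition _ := GRing.Zmodule_isLmodule.Build A btensor
  btensor_scalerA btensor_scale1r sD btensor_scalerDl.

Lemma scale_btens a m n : a *: btens m n = btens (a *: m) n.
Proof. exact: sE. Qed.

Let rDr x a b : btensor_rscale x (a + b) = btensor_rscale x a + btensor_rscale x b.
Proof.
move: x; apply: btens_ext => [x y|x y|m n]; rewrite ?rB //.
  by rewrite subrDD.
by rewrite !rE rscaleDr btensDr.
Qed.

Let rA x a b : btensor_rscale (btensor_rscale x a) b = btensor_rscale x (a * b).
Proof.
move: x; apply: btens_ext => [x y|x y|m n]; rewrite ?rB //.
by rewrite !rE rscaleA.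
Qed.

Let r1 x : btensor_rscale x 1 = x.
Proof.
by move: x; apply: btens_ext => [x y|x y|m n]; rewrite ?rB // rE rscale1.
Qed.

Let rZ a (x : btensor) b : btensor_rscale (a *: x) b = a *: btensor_rscale x b.
Proof.
move: x; apply: btens_ext => [x y|x y|m n].
- by rewrite scalerBr rB.
- by rewrite rB scalerBr.
- by rewrite scale_btens !rE scale_btens.
Qed.

HB.instance Definition _ := Lmodule_isBimodule.Build A btensor rD rDr rA r1 rZ.

Lemma rscale_btens m n a : rscale (btens m n) a = btens m (rscale n a).
Proof. exact: rE. Qed.

End BimodTensor.

(** [A] as a left and as a right [R]-module along [f]; these are copies of the
    type [A], tagged by [f] so as to carry their own scaling. *)
Definition lrestr (R A : pzRingType) (f : {rmorphism R -> A}) : Type := A.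
Definition rrestr (R A : pzRingType) (f : {rmorphism R -> A}) : Type := A.

Section Complex.
Variables (R A : pzRingType) (f : {rmorphism R -> A}).

Local Notation lrestr := (lrestr f).
Local Notation rrestr := (rrestr f).

HB.instance Definition _ := GRing.Zmodule.on lrestr.

Definition lrestr_scale (r : R) (a : lrestr) : lrestr := (f r : A) * (a : A).

Let lA r s (a : lrestr) :
  lrestr_scale r (lrestr_scale s a) = lrestr_scale (r * s) a.
Proof. by rewrite /lrestr_scale rmorphM mulrA. Qed.
Let l1 : left_id 1 lrestr_scale.
Proof. by move=> a; rewrite /lrestr_scale rmorph1 mul1r. Qed.
Let lDr : right_distributive lrestr_scale +%R.
Proof. by move=> r a b; apply: mulrDr. Qed.
Let lDl (a : lrestr) : {morph lrestr_scale^~ a : r s / r + s}.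
Proof. by move=> r s; rewrite /lrestr_scale rmorphD mulrDl. Qed.

HB.instance Definition _ :=
  GRing.Zmodule_isLmodule.Build R lrestr lA l1 lDr lDl.

HB.instance Definition _ := GRing.Zmodule.on rrestr.

Definition rrestr_scale (r : R^c) (a : rrestr) : rrestr := (a : A) * (f r : A).

Let rA (r s : R^c) (a : rrestr) :
  rrestr_scale r (rrestr_scale s a) = rrestr_scale (r * s) a.
Proof.
rewrite /rrestr_scale -mulrA -rmorphM; congr (_ * f _).
Qed.
Let r1 : left_id 1 rrestr_scale.
Proof. by move=> a; rewrite /rrestr_scale [X in _ * X]rmorph1 mulr1. Qed.
Let rDr : right_distributive rrestr_scale +%R.
Proof. by move=> r a b; apply: mulrDl. Qed.
Let rDl (a : rrestr) : {morph rrestr_scale^~ a : r s / r + s}.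
Proof. by move=> r s; rewrite /rrestr_scale [X in _ * X]rmorphD; apply: mulrDr. Qed.

HB.instance Definition _ :=
  GRing.Zmodule_isLmodule.Build R^c rrestr rA r1 rDr rDl.

(** [A ⊗_R A], with [a (x ⊗ y) b = a x ⊗ y b]. *)
Definition AA : Type :=
  tensor (fun (x : A) (r : R) => x * f r) (fun (r : R) (y : A) => f r * y).
HB.instance Definition _ := GRing.Zmodule.on AA.

Definition AAtens (x y : A) : AA :=
  tens (fun (x : A) (r : R) => x * f r) (fun (r : R) (y : A) => f r * y) x y.

Local Notation bal phi :=
  (balanced (fun (x : A) (r : R) => x * f r) (fun (r : R) (y : A) => f r * y) phi).

Definition AAmul : AA -> A := tlift (fun x y : A => x * y).
Definition AAscale (a : A) : AA -> AA := tlift (fun x y : A => AAtens (a * x) y).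
Definition AArscale (z : AA) (b : A) : AA := tlift (fun x y : A => AAtens x (y * b)) z.

Lemma AAtensDl x x' y : AAtens (x + x') y = AAtens x y + AAtens x' y.
Proof. exact: tensDl. Qed.
Lemma AAtensDr x y y' : AAtens x (y + y') = AAtens x y + AAtens x y'.
Proof. exact: tensDr. Qed.
Lemma AAtensBl x x' y : AAtens (x - x') y = AAtens x y - AAtens x' y.
Proof. exact: tensBl. Qed.
Lemma AAtensBr x y y' : AAtens x (y - y') = AAtens x y - AAtens x y'.
Proof. exact: tensBr. Qed.
Lemma AAtensA x r y : AAtens (x * f r) y = AAtens x (f r * y).
Proof. exact: (tensA (fun (x : A) (r : R) => x * f r) (fun (r : R) (y : A) => f r * y)). Qed.

Lemma AA_ext (Z : zmodType) (g h : AA -> Z) :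
    zmod_morphism g -> zmod_morphism h ->
    (forall x y, g (AAtens x y) = h (AAtens x y)) -> g =1 h.
Proof. exact: tens_ext. Qed.

Lemma AAmul_bal : bal (fun x y : A => x * y).
Proof. by split=> *; rewrite ?mulrDl ?mulrDr ?mulrA. Qed.

Lemma AAscale_bal a : bal (fun x y : A => AAtens (a * x) y).
Proof. by split=> *; rewrite ?mulrDr ?AAtensDl ?AAtensDr // mulrA AAtensA. Qed.

Lemma AArscale_bal b : bal (fun x y : A => AAtens x (y * b)).
Proof. by split=> *; rewrite ?mulrDl ?AAtensDl ?AAtensDr // AAtensA mulrA. Qed.

Lemma AAmulE x y : AAmul (AAtens x y) = x * y.
Proof. exact: (tliftE AAmul_bal). Qed.
Lemma AAmulB : zmod_morphism AAmul.
Proof. exact: (tlift_is_zmod_morphism AAmul_bal). Qed.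
HB.instance Definition _ := GRing.isZmodMorphism.Build AA A AAmul AAmulB.

Lemma AAscaleE a x y : AAscale a (AAtens x y) = AAtens (a * x) y.
Proof. exact: (tliftE (AAscale_bal a)). Qed.
Lemma AAscaleB a : zmod_morphism (AAscale a).
Proof. exact: (tlift_is_zmod_morphism (AAscale_bal a)). Qed.
Lemma AAscaleD a z w : AAscale a (z + w) = AAscale a z + AAscale a w.
Proof. exact: (tliftD (AAscale_bal a)). Qed.

Lemma AArscaleE x y b : AArscale (AAtens x y) b = AAtens x (y * b).
Proof. exact: (tliftE (AArscale_bal b)). Qed.
Lemma AArscaleB b : zmod_morphism (AArscale ^~ b).
Proof. exact: (tlift_is_zmod_morphism (AArscale_bal b)). Qed.
Lemma AArscaleD z w b : AArscale (z + w) b = AArscale z b + AArscale w b.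
Proof. exact: (tliftD (AArscale_bal b)). Qed.

Let subrDD (V : zmodType) (a b c d : V) : a + b - (c + d) = a - c + (b - d).
Proof. by rewrite opprD addrACA. Qed.

Let asA a b z : AAscale a (AAscale b z) = AAscale (a * b) z.
Proof.
move: z; apply: AA_ext => [z w|z w|x y]; rewrite ?AAscaleB //.
by rewrite !AAscaleE mulrA.
Qed.
Let as1 : left_id 1 AAscale.
Proof. by apply: AA_ext => [z w|z w|x y]; rewrite ?AAscaleB // AAscaleE mul1r. Qed.
Let asDl z : {morph AAscale^~ z : a b / a + b}.
Proof.
move=> a b /=; move: z; apply: AA_ext => [z w|z w|x y]; rewrite ?AAscaleB //.
  by rewrite subrDD.
by rewrite !AAscaleE mulrDl AAtensDl.
Qed.

HB.instance Definition _ :=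
  GRing.Zmodule_isLmodule.Build A AA asA as1 AAscaleD asDl.

Lemma scale_AAtens a x y : a *: AAtens x y = AAtens (a * x) y.
Proof. exact: AAscaleE. Qed.

Let arDr z a b : AArscale z (a + b) = AArscale z a + AArscale z b.
Proof.
move: z; apply: AA_ext => [z w|z w|x y]; rewrite ?AArscaleB //.
  by rewrite subrDD.
by rewrite !AArscaleE mulrDr AAtensDr.
Qed.
Let arA z a b : AArscale (AArscale z a) b = AArscale z (a * b).
Proof.
move: z; apply: AA_ext => [z w|z w|x y]; rewrite ?AArscaleB //.
by rewrite !AArscaleE mulrA.
Qed.
Let ar1 z : AArscale z 1 = z.
Proof.
by move: z; apply: AA_ext => [z w|z w|x y]; rewrite ?AArscaleB // AArscaleE mulr1.
Qed.
Let arZ a (z : AA) b : AArscale (a *: z) b = a *: AArscale z b.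
Proof.
move: z; apply: AA_ext => [z w|z w|x y].
- by rewrite scalerBr AArscaleB.
- by rewrite AArscaleB scalerBr.
- by rewrite scale_AAtens !AArscaleE scale_AAtens.
Qed.

HB.instance Definition _ :=
  Lmodule_isBimodule.Build A AA AArscaleD arDr arA ar1 arZ.

Lemma rscale_AAtens x y b : rscale (AAtens x y) b = AAtens x (y * b).
Proof. exact: AArscaleE. Qed.

Lemma AAmulZ a z : AAmul (a *: z) = a * AAmul z.
Proof.
move: z; apply: AA_ext => [z w|z w|x y].
- by rewrite scalerBr raddfB.
- by rewrite raddfB mulrBr.
- by rewrite scale_AAtens !AAmulE mulrA.
Qed.

Lemma AAmul_rscale z b : AAmul (rscale z b) = AAmul z * b.
Proof.
move: z; apply: AA_ext => [z w|z w|x y].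
- by rewrite rscaleBl raddfB.
- by rewrite raddfB mulrBl.
- by rewrite rscale_AAtens !AAmulE mulrA.
Qed.

Definition K_mem (z : AA) : bool := AAmul z == 0.

Lemma K_zmod_closed : zmod_closed K_mem.
Proof.
split; first by rewrite unfold_in /K_mem raddf0.
move=> z w; rewrite !unfold_in /K_mem raddfB.
by move=> /eqP hz /eqP hw; rewrite /= hz hw subrr.
Qed.
HB.instance Definition _ := GRing.isZmodClosed.Build AA K_mem K_zmod_closed.

Record K : Type := InK { K_val : AA; K_valP : K_mem K_val }.
HB.instance Definition _ := [isSub for K_val].
HB.instance Definition _ := [Choice of K by <:].
HB.instance Definition _ := [SubChoice_isSubZmodule of K by <:].

Lemma K_inj (z w : K) : K_val z = K_val w -> z = w.
Proof. exact: val_inj. Qed.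
Lemma K_valB (z w : K) : K_val (z - w) = K_val z - K_val w.
Proof. exact: (raddfB val). Qed.
Lemma K_valD (z w : K) : K_val (z + w) = K_val z + K_val w.
Proof. exact: (raddfD val). Qed.

Lemma KP (z : K) : AAmul (K_val z) = 0.
Proof. exact/eqP/K_valP. Qed.

Lemma K_scale_subproof a (z : K) : AAmul (a *: K_val z) == 0.
Proof. by rewrite AAmulZ KP mulr0. Qed.
Definition K_scale a z : K := InK (K_scale_subproof a z).

Lemma K_rscale_subproof (z : K) b : AAmul (rscale (K_val z) b) == 0.
Proof. by rewrite AAmul_rscale KP mul0r. Qed.
Definition K_rscale z b : K := InK (K_rscale_subproof z b).

Let ksA a b z : K_scale a (K_scale b z) = K_scale (a * b) z.
Proof. by apply: K_inj => /=; rewrite scalerA. Qed.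
Let ks1 : left_id 1 K_scale.
Proof. by move=> z; apply: K_inj => /=; rewrite scale1r. Qed.
Let ksDr : right_distributive K_scale +%R.
Proof. by move=> a z w; apply: K_inj; rewrite [RHS]K_valD [RHS]/= -scalerDr -K_valD. Qed.
Let ksDl z : {morph K_scale^~ z : a b / a + b}.
Proof. by move=> a b; apply: K_inj; rewrite [RHS]K_valD /= scalerDl. Qed.
HB.instance Definition _ := GRing.Zmodule_isLmodule.Build A K ksA ks1 ksDr ksDl.

Let krDl (z w : K) a : K_rscale (z + w) a = K_rscale z a + K_rscale w a.
Proof. by apply: K_inj; rewrite [RHS]K_valD [RHS]/= -rscaleDl -K_valD. Qed.
Let krDr z a b : K_rscale z (a + b) = K_rscale z a + K_rscale z b.
Proof. by apply: K_inj; rewrite [RHS]K_valD /= rscaleDr. Qed.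
Let krA z a b : K_rscale (K_rscale z a) b = K_rscale z (a * b).
Proof. by apply: K_inj => /=; rewrite rscaleA. Qed.
Let kr1 z : K_rscale z 1 = z.
Proof. by apply: K_inj => /=; rewrite rscale1. Qed.
Let krZ a (z : K) b : K_rscale (a *: z) b = a *: K_rscale z b.
Proof. by apply: K_inj => /=; rewrite rscaleZ. Qed.
HB.instance Definition _ := Lmodule_isBimodule.Build A K krDl krDr krA kr1 krZ.

Lemma K_valZ a (z : K) : K_val (a *: z) = a *: K_val z. Proof. by []. Qed.
Lemma K_val_rscale (z : K) b : K_val (rscale z b) = rscale (K_val z) b.
Proof. by []. Qed.
Lemma dA_subproof a : AAmul (AAtens 1 a - AAtens a 1) == 0.
Proof. by rewrite raddfB /= !AAmulE mul1r mulr1 subrr. Qed.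
Definition dA (a : A) : K := InK (dA_subproof a).

Lemma dAB a b : dA (a - b) = dA a - dA b.
Proof.
apply: K_inj; rewrite K_valB /= AAtensBl AAtensBr.
by rewrite !opprD addrACA.
Qed.

Lemma dA0 : dA 0 = 0. Proof. by rewrite -(subrr 0) dAB subrr. Qed.
Lemma dAD a b : dA (a + b) = dA a + dA b.
Proof. by rewrite -{1}[b]opprK dAB -[- b]sub0r dAB dA0 sub0r opprK. Qed.

Lemma dAM a b : dA (a * b) = rscale (dA a) b + a *: dA b.
Proof.
apply: K_inj; rewrite K_valD /= rscaleBl scalerBr !rscale_AAtens !scale_AAtens.
by rewrite mul1r mulr1 addrA subrK.
Qed.

Lemma dA_unit r : dA (f r) = 0.
Proof.
by apply: K_inj; rewrite /= -[f r as X in AAtens X 1]mul1r AAtensA mulr1 subrr.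
Qed.

End Complex.

Section Differential.
Variables (R A : pzRingType) (f : {rmorphism R -> A}).
Local Notation K := (K f).
Local Notation AA := (AA f).
Local Notation AAtens := (AAtens f).
Local Notation dA := (dA f).
Local Notation bal phi :=
  (balanced (fun (x : A) (r : R) => x * f r) (fun (r : R) (y : A) => f r * y) phi).

(** For [κ = Σ x ∂y] in [K], [dK κ w = Σ ∂x ⊗ ∂y ⊗ w], and [dK2 κ = Σ ∂x ⊗ ∂y];
    note [κ = Σ x ⊗ y] implies [κ = Σ x ∂y] since then [Σ x y = 0]. *)
Definition dK (M : bimodType A) (z : K) (w : M) : btensor K (btensor K M) :=
  tlift (fun x y : A => btens (dA x) (btens (dA y) w)) (K_val z).

Definition dK2 (z : K) : btensor K K :=
  tlift (fun x y : A => btens (dA x) (dA y)) (K_val z).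

Lemma dA_rl x r y :
  dA (x * f r) = rscale (dA x) (f r) /\ dA (f r * y) = f r *: dA y.
Proof.
by rewrite !dAM !dA_unit scaler0 addr0; split=> //;
  rewrite -[0](subrr 0) rscaleBl subrr add0r.
Qed.

Lemma dK_bal (M : bimodType A) (w : M) :
  bal (fun x y : A => btens (dA x) (btens (dA y) w)).
Proof.
split=> [x x' y|x y y'|x r y].
- by rewrite dAD btensDl.
- by rewrite dAD btensDl btensDr.
- by rewrite (dA_rl x r y).1 (dA_rl x r y).2 btensA scale_btens.
Qed.

Lemma dK2_bal : bal (fun x y : A => btens (dA x) (dA y)).
Proof.
split=> [x x' y|x y y'|x r y].
- by rewrite dAD btensDl.
- by rewrite dAD btensDr.
- by rewrite (dA_rl x r y).1 (dA_rl x r y).2 btensA.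
Qed.

(** [AAl (Σ x ⊗ y) = Σ x ∂y] and [AAr (Σ x ⊗ y) = Σ (∂x) y]. *)
Definition AAl : AA -> K := tlift (fun x y : A => x *: dA y).
Definition AAr : AA -> K := tlift (fun x y : A => rscale (dA x) y).

Lemma AAl_bal : bal (fun x y : A => x *: dA y).
Proof.
split=> [x x' y|x y y'|x r y]; first by rewrite scalerDl.
  by rewrite dAD scalerDr.
by rewrite (dA_rl x r y).2 scalerA.
Qed.
Lemma AAr_bal : bal (fun x y : A => rscale (dA x) y).
Proof.
split=> [x x' y|x y y'|x r y]; first by rewrite dAD rscaleDl.
  by rewrite rscaleDr.
by rewrite (dA_rl x r y).1 rscaleA.
Qed.
Lemma AAlB : zmod_morphism AAl. Proof. exact: (tliftB AAl_bal). Qed.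
Lemma AArB : zmod_morphism AAr. Proof. exact: (tliftB AAr_bal). Qed.
Lemma AAlE x y : AAl (AAtens x y) = x *: dA y.
Proof. exact: (tliftE AAl_bal). Qed.
Lemma AArE x y : AAr (AAtens x y) = rscale (dA x) y.
Proof. exact: (tliftE AAr_bal). Qed.

Let subrACA (V : zmodType) (a b c d : V) : a - b - (c - d) = a - c - (b - d).
Proof. by rewrite !opprD addrACA. Qed.

Lemma AAl_K (z : K) : AAl (K_val z) = z.
Proof.
suff H : forall t : AA, K_val (AAl t) = t - AAtens (AAmul t) 1.
  by apply: K_inj; rewrite H KP -(subrr 0) AAtensBl subrr subr0.
apply: AA_ext => [s t|s t|x y].
- by rewrite AAlB K_valB.
- by rewrite [AAmul (s - t)]raddfB AAtensBl subrACA.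
- by rewrite AAlE K_valZ /= scalerBr !scale_AAtens mulr1 AAmulE.
Qed.

Lemma AAr_K (z : K) : AAr (K_val z) = - z.
Proof.
suff H : forall t : AA, K_val (AAr t) = AAtens 1 (AAmul t) - t.
  apply: K_inj; rewrite H KP -[- z]sub0r K_valB.
  by rewrite -[X in AAtens 1 X](subrr 0) AAtensBr subrr; congr (_ - _);
    rewrite -(subrr 0) K_valB subrr.
apply: AA_ext => [s t|s t|x y].
- by rewrite AArB K_valB.
- by rewrite [AAmul (s - t)]raddfB AAtensBr subrACA.
- by rewrite AArE K_val_rscale /= rscaleBl !rscale_AAtens mul1r AAmulE.
Qed.

Section DK.
Variable M : bimodType A.
Implicit Types (z : K) (w : M).

Let dKt w : AA -> btensor K (btensor K M) :=
  tlift (fun x y : A => btens (dA x) (btens (dA y) w)).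
Let dKtB w : zmod_morphism (dKt w). Proof. exact: (tliftB (dK_bal w)). Qed.
Let dKtE w x y : dKt w (AAtens x y) = btens (dA x) (btens (dA y) w).
Proof. exact: (tliftE (dK_bal w)). Qed.

Lemma dKBl z z' w : dK (z - z') w = dK z w - dK z' w.
Proof. by rewrite /dK K_valB -/(dKt w) dKtB. Qed.

Lemma dKBr z w w' : dK z (w - w') = dK z w - dK z w'.
Proof.
rewrite /dK -!/(dKt _); move: (K_val z); apply: AA_ext => [s t|s t|x y].
- exact: dKtB.
- by rewrite !dKtB subrACA.
- by rewrite !dKtE !btensBr.
Qed.

Lemma dKZ a z w : dK (a *: z) w = btens (dA a) (btens z w) + a *: dK z w.
Proof.
suff H : forall t : AA,
    dKt w (a *: t) = btens (dA a) (btens (AAl t) w) + a *: dKt w t.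
  by rewrite /dK -!/(dKt _) K_valZ H AAl_K.
apply: AA_ext => [s t|s t|x y].
- by rewrite scalerBr dKtB.
- by rewrite AAlB dKtB btensBl btensBr scalerBr opprD addrACA.
- rewrite scale_AAtens !dKtE AAlE dAM btensDl scale_btens btensA.
  by rewrite scale_btens.
Qed.

Lemma dK_rscale z a w :
  dK (rscale z a) w = dK z (a *: w) - btens z (btens (dA a) w).
Proof.
suff H : forall t : AA,
    dKt w (rscale t a) = dKt (a *: w) t + btens (AAr t) (btens (dA a) w).
  rewrite /dK -!/(dKt _) K_val_rscale H AAr_K; congr (_ + _).
  by rewrite -[- z]sub0r btensBl btens0l sub0r.
apply: AA_ext => [s t|s t|x y].
- by rewrite rscaleBl dKtB.
- by rewrite AArB dKtB !btensBl opprD addrACA.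
- rewrite rscale_AAtens !dKtE AArE dAM btensDl btensDr; congr (_ + _).
    by rewrite btensA.
  by rewrite -scale_btens btensA.
Qed.

Lemma dK_dA a w : dK (dA a) w = 0.
Proof.
rewrite /dK -/(dKt w) /= dKtB !dKtE -(rmorph1 f) dA_unit !btens0l btens0r.
by rewrite subrr.
Qed.

End DK.

Lemma dK2B z z' : dK2 (z - z') = dK2 z - dK2 z'.
Proof. by rewrite /dK2 K_valB (tliftB dK2_bal). Qed.

Lemma dK2Z a z : dK2 (a *: z) = btens (dA a) z + a *: dK2 z.
Proof.
pose g : AA -> btensor K K := tlift (fun x y : A => btens (dA x) (dA y)).
have gB : zmod_morphism g by apply: (tliftB dK2_bal).
have gE x y : g (AAtens x y) = btens (dA x) (dA y) by apply: (tliftE dK2_bal).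
suff H : forall t : AA, g (a *: t) = btens (dA a) (AAl t) + a *: g t.
  by rewrite /dK2 -/g K_valZ H AAl_K.
apply: AA_ext => [s t|s t|x y].
- by rewrite scalerBr gB.
- by rewrite AAlB gB btensBr scalerBr opprD addrACA.
- by rewrite scale_AAtens !gE AAlE dAM btensDl scale_btens btensA.
Qed.

Lemma dK2_dA a : dK2 (dA a) = 0.
Proof.
rewrite /dK2 /= (tliftB dK2_bal) !(tliftE dK2_bal) -(rmorph1 f) dA_unit.
by rewrite btens0l btens0r subrr.
Qed.

(** The terms [Q_n], [n >= 2], are built together with their differential; the
    recursion needs the graded Leibniz rule of the latter. *)
Record stage := Stage {
  st :> bimodType A;
  st_d : st -> btensor K st;
  st_dB : zmod_morphism st_d;
  st_dZ : forall a w, st_d (a *: w) = btens (dA a) w + a *: st_d w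
}.

Definition stage0 : stage := Stage dK2B dK2Z.

Section Next.
Variable M : stage.

(** [∂ (κ ⊗ w) = ∂κ ⊗ w - κ ⊗ ∂w]. *)
Definition next_d : btensor K M -> btensor K (btensor K M) :=
  tlift (fun (z : K) (w : M) => dK z w - btens z (st_d w)).

Lemma next_d_bal :
  balanced (@rscale A K) (fun (a : A) (w : M) => a *: w)
    (fun (z : K) (w : M) => dK z w - btens z (st_d w)).
Proof.
have toD (V W : zmodType) (g : V -> W) : zmod_morphism g ->
    forall x y, g (x + y) = g x + g y.
  move=> gB x y; have g0 : g 0 = 0 by rewrite -(subrr 0) gB subrr.
  by rewrite -{1}[y]opprK gB -[- y]sub0r gB g0 sub0r opprK.
split=> [z z' w|z w w'|z a w].
- apply: (toD _ _ (fun z => dK z w - btens z (st_d w))) => x y.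
  by rewrite dKBl btensBl subrACA.
- apply: (toD _ _ (fun w => dK z w - btens z (st_d w))) => x y.
  by rewrite dKBr st_dB btensBr subrACA.
- by rewrite dK_rscale st_dZ btensDr btensA opprD addrA.
Qed.

Lemma next_dE z w : next_d (btens z w) = dK z w - btens z (st_d w).
Proof. exact: (tliftE next_d_bal). Qed.

Lemma next_dB : zmod_morphism next_d.
Proof. exact: (tliftB next_d_bal). Qed.

Lemma next_dZ a x : next_d (a *: x) = btens (dA a) x + a *: next_d x.
Proof.
move: x; apply: btens_ext => [x y|x y|z w].
- by rewrite scalerBr next_dB.
- by rewrite next_dB scalerBr btensBr opprD addrACA.
- by rewrite scale_btens !next_dE dKZ scalerBr scale_btens addrA.
Qed.

Definition next_stage : stage := Stage next_dB next_dZ.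
End Next.

Fixpoint stages (n : nat) : stage :=
  if n is m.+1 then next_stage (stages m) else stage0.

Definition Q (n : nat) : zmodType :=
  match n with 0 => R | 1 => A | m.+2 => stages m end.

Definition dQ (n : nat) : Q n -> Q n.+1 :=
  match n with 0 => f | 1 => dA | m.+2 => @st_d (stages m) end.

Definition Qact (n : nat) : Q n -> R -> Q n :=
  match n with
  | 0 => fun q r => q * r
  | 1 => fun q r => q * f r
  | m.+2 => fun q r => rscale (q : stages m) (f r)
  end.

(** [word a n = ∂a_0 ⊗ ... ⊗ ∂a_n]. *)
Fixpoint word (a : nat -> A) (n : nat) : stages n :=
  match n with
  | 0 => dA (a 0)
  | m.+1 => btens (dA (a 0)) (word (a \o S) m)
  end.

Lemma st_d_word a n : st_d (word a n) = 0.
Proof.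
elim: n a => [|n IHn] a; first exact: dK2_dA.
by rewrite [LHS]next_dE dK_dA IHn btens0r subrr.
Qed.

(** [∂ (b ∂a_0 ⊗ ... ⊗ ∂a_n) = ∂b ⊗ ∂a_0 ⊗ ... ⊗ ∂a_n]; as the arguments
    span [Q_(n+2)] (next lemma), this determines [∂]. *)
Lemma dQ_word (b : A) (a : nat -> A) n :
  @dQ n.+2 (b *: word a n) = word (fun i => if i is j.+1 then a j else b) n.+1.
Proof. by rewrite [LHS]st_dZ st_d_word scaler0 addr0. Qed.

Lemma word_span n (P : stages n -> Prop) :
    (forall x y, P x -> P y -> P (x - y)) ->
    (forall b a, P (b *: word a n)) -> forall x, P x.
Proof.
elim: n P => [|n IHn] P PB Pw.
  move=> z; rewrite -(AAl_K z); elim/tens_ind: (K_val z) => [s t hs ht|x y].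
    by rewrite AAlB; apply: PB.
  by rewrite [AAl _]AAlE; apply: (Pw x (fun=> y)).
elim/tens_ind => // z w; apply: (IHn (fun w => P (btens z w))) => [x y hx hy|b a].
  by rewrite btensBr; apply: PB.
rewrite -btensA -(AAl_K (rscale z b)).
elim/tens_ind: (K_val _) => [s t hs ht|x y]; first by rewrite AAlB btensBl; apply: PB.
rewrite [AAl _]AAlE -scale_btens.
exact: (Pw x (fun i => if i is j.+1 then a j else y)).
Qed.

End Differential.

Section DirectSum.
Variable V : nat -> zmodType.

Record dsum : Type := Dsum {
  dval :> forall n, V n;
  dvalP : exists N, forall n, (N <= n)%N -> dval n = 0
}.

Lemma dsumP (x y : dsum) : (forall n, x n = y n) -> x = y.
Proof.
case: x y => [x hx] [y hy] /= e.
have {}e : x = y by apply: functional_extensionality_dep.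
by subst y; congr Dsum; apply: Prop_irrelevance.
Qed.

HB.instance Definition _ := gen_eqMixin dsum.
HB.instance Definition _ := gen_choiceMixin dsum.

Lemma dsum0_subproof : exists N, forall n, (N <= n)%N -> (0 : V n) = 0.
Proof. by exists 0. Qed.
Definition dsum0 : dsum := Dsum dsum0_subproof.

Lemma dsumN_subproof (x : dsum) : exists N, forall n, (N <= n)%N -> - x n = 0.
Proof. by case: (dvalP x) => N h; exists N => n /h ->; rewrite oppr0. Qed.
Definition dsumN (x : dsum) : dsum := Dsum (dsumN_subproof x).

Lemma dsumD_subproof (x y : dsum) :
  exists N, forall n, (N <= n)%N -> x n + y n = 0.
Proof.
case: (dvalP x) (dvalP y) => N h [N' h']; exists (maxn N N') => n.
by rewrite geq_max => /andP[/h -> /h' ->]; rewrite addr0.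
Qed.
Definition dsumD (x y : dsum) : dsum := Dsum (dsumD_subproof x y).

Let dsumDA : associative dsumD.
Proof. by move=> x y z; apply: dsumP => n /=; rewrite addrA. Qed.
Let dsumDC : commutative dsumD.
Proof. by move=> x y; apply: dsumP => n /=; rewrite addrC. Qed.
Let dsum0D : left_id dsum0 dsumD.
Proof. by move=> x; apply: dsumP => n /=; rewrite add0r. Qed.
Let dsumND : left_inverse dsum0 dsumN dsumD.
Proof. by move=> x; apply: dsumP => n /=; rewrite addNr. Qed.
HB.instance Definition _ := GRing.isZmodule.Build dsum dsumDA dsumDC dsum0D dsumND.

Lemma dvalD (x y : dsum) n : (x + y) n = x n + y n. Proof. by []. Qed.
Lemma dvalB (x y : dsum) n : (x - y) n = x n - y n. Proof. by []. Qed.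
Lemma dval0 n : (0 : dsum) n = 0. Proof. by []. Qed.

End DirectSum.

(** In the ring [C = R^(ℕ) ⊕ R^(ℕ)], which has no identity, the pair [(a, b)]
    stands for [Σ a_n h_n + Σ b_n u_n]. *)
Section RingC.
Variable R : pzRingType.

Definition C : zmodType := (dsum (fun=> R) * dsum (fun=> R))%type.

Lemma Cmul1_subproof (c d : C) :
  exists N, forall n, (N <= n)%N -> c.1 n * d.1 n = 0.
Proof. by case: (dvalP c.1) => N h; exists N => n /h ->; rewrite mul0r. Qed.

Lemma Cmul2_subproof (c d : C) :
  exists N, forall n, (N <= n)%N -> c.1 n * d.2 n + c.2 n * d.1 n.+1 = 0.
Proof.
case: (dvalP c.1) (dvalP c.2) => N h [N' h']; exists (maxn N N') => n.
by rewrite geq_max => /andP[/h -> /h' ->]; rewrite !mul0r addr0.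
Qed.

Definition Cmul (c d : C) : C :=
  (@Dsum (fun=> R) _ (Cmul1_subproof c d), @Dsum (fun=> R) _ (Cmul2_subproof c d)).

Lemma single_subproof (n : nat) (r : R) :
  exists N, forall m, (N <= m)%N -> (if m == n then r else 0) = 0.
Proof. by exists n.+1 => m; case: eqP => // ->; rewrite ltnn. Qed.
Definition single (n : nat) (r : R) : dsum (fun=> R) :=
  @Dsum (fun=> R) _ (single_subproof n r).

(** [Ch n r = r h_n] and [Cu n r = r u_n]. *)
Definition Ch (n : nat) (r : R) : C := (single n r, 0).
Definition Cu (n : nat) (r : R) : C := (0, single n r).

Lemma CP (c d : C) : c.1 =1 d.1 -> c.2 =1 d.2 -> c = d.
Proof.
by case: c d => [a b] [a' b'] /= e1 e2; congr (_, _); apply: dsumP.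
Qed.

Lemma CmulA : associative Cmul.
Proof.
move=> x y z; apply: CP => n /=; first by rewrite mulrA.
by rewrite mulrDr mulrDl !mulrA addrA.
Qed.

Lemma CmulDl : left_distributive Cmul +%R.
Proof.
move=> x y z; apply: CP => n; first exact: mulrDl.
by rewrite [RHS]addrACA -!mulrDl.
Qed.

Lemma CmulDr : right_distributive Cmul +%R.
Proof.
move=> x y z; apply: CP => n; first exact: mulrDr.
by rewrite [RHS]addrACA -!mulrDr.
Qed.

Lemma Cmul_hh n m r s : Cmul (Ch n r) (Ch m s) = if n == m then Ch n (r * s) else 0.
Proof.
apply: CP => i; case: (eqVneq n m) => [<-|nm] /=; rewrite ?mulr0 ?mul0r ?addr0 //.
  by case: eqP; rewrite ?mulr0 ?mul0r.
case: (eqVneq i n) => [->|_]; rewrite ?mul0r //.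
by rewrite (negPf nm) mulr0.
Qed.

Lemma Cmul_hu n m r s : Cmul (Ch n r) (Cu m s) = if n == m then Cu n (r * s) else 0.
Proof.
apply: CP => i; case: (eqVneq n m) => [<-|nm] /=; rewrite ?mulr0 ?mul0r ?addr0 //.
  by case: eqP; rewrite ?mulr0 ?mul0r ?addr0.
case: (eqVneq i n) => [->|_]; rewrite ?mul0r ?addr0 //.
by rewrite (negPf nm) mulr0.
Qed.

Lemma Cmul_uh n m r s :
  Cmul (Cu n r) (Ch m s) = if m == n.+1 then Cu n (r * s) else 0.
Proof.
apply: CP => i; case: (eqVneq m n.+1) => [->|nm] /=;
  rewrite ?mulr0 ?mul0r ?add0r //.
  by rewrite eqSS; case: eqP; rewrite ?mulr0.
case: (eqVneq i n) => [->|_]; rewrite ?mul0r ?addr0 //.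
by rewrite eq_sym (negPf nm) mulr0.
Qed.

Lemma Cmul_uu n m r s : Cmul (Cu n r) (Cu m s) = 0.
Proof. by apply: CP => i; rewrite /= ?mul0r ?mulr0 ?addr0. Qed.

(** Unital left modules: [M] is the sum of the [h_n M], and the sum is direct
    because the [h_n] are orthogonal idempotents (see [cmod_direct]). *)
Record cmod := Cmod {
  cmod_sort :> zmodType;
  cact : C -> cmod_sort -> cmod_sort;
  cactDl : forall c d x, cact (c + d) x = cact c x + cact d x;
  cactDr : forall c x y, cact c (x + y) = cact c x + cact c y;
  cactA : forall c d x, cact (Cmul c d) x = cact c (cact d x);
  cact_unital : forall x, exists N (y : nat -> cmod_sort),
    x = \sum_(n < N) cact (Ch n 1) (y n)
}.

Lemma cact0l (M : cmod) (x : M) : cact 0 x = 0.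
Proof. by apply: (addrI (cact 0 x)); rewrite -cactDl !addr0. Qed.

Lemma cact0r (M : cmod) c : cact c (0 : M) = 0.
Proof. by apply: (addrI (cact c 0)); rewrite -cactDr !addr0. Qed.

Lemma cmod_direct (M : cmod) N (y : nat -> M) :
    \sum_(n < N) cact (Ch n 1) (y n) = 0 ->
  forall n, (n < N)%N -> cact (Ch n 1) (y n) = 0.
Proof.
move=> e n nN; have := congr1 (cact (Ch n 1)) e; rewrite cact0r => <-.
rewrite (big_morph _ (@cactDr M _) (@cact0r M _)) (bigD1 (Ordinal nN)) //=.
rewrite -cactA Cmul_hh eqxx mulr1 big1 ?addr0 // => i.
rewrite -val_eqE /= => ni; rewrite -cactA Cmul_hh eq_sym (negPf ni).
exact: cact0l.
Qed.

Definition C_linear (M N : cmod) (g : M -> N) : Prop :=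
  zmod_morphism g /\ forall c x, g (cact c x) = cact c (g x).

Definition short_exact (X Y Z : zmodType) (i : X -> Y) (p : Y -> Z) : Prop :=
  [/\ injective i,
      forall y, p y = 0 <-> exists x, i x = y
    & forall z, exists y, p y = z].

(** The right [C]-module is given by a group [V] and an action [va]. *)
Section Flatness.
Variables (V : zmodType) (va : V -> C -> V).

Definition Ctensor (M : cmod) : zmodType := tensor va (@cact M).

Definition Ctensor_map (M N : cmod) (g : M -> N) : Ctensor M -> Ctensor N :=
  tlift (fun v x => tens va (@cact N) v (g x)).

Definition C_flat : Prop :=
  forall (M N P : cmod) (i : M -> N) (p : N -> P),
    C_linear i -> C_linear p -> short_exact i p ->
    short_exact (Ctensor_map i) (Ctensor_map p).

Definition C_faithful : Prop :=
  forall (M N : cmod) (g h : M -> N), C_linear g -> C_linear h ->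
    Ctensor_map g =1 Ctensor_map h -> g =1 h.

Definition C_faithfully_flat : Prop := C_flat /\ C_faithful.

Lemma Ctensor_map_bal (M N : cmod) (g : M -> N) : C_linear g ->
  balanced va (@cact M) (fun v x => tens va (@cact N) v (g x)).
Proof.
case=> gB gC; split=> [v v' x|v x x'|v c x]; first exact: tensDl.
  rewrite -tensDr; congr tens.
  have g0 : g 0 = 0 by rewrite -(subrr 0) gB subrr.
  by rewrite -{1}[x']opprK gB -[- x']sub0r gB g0 sub0r opprK.
by rewrite tensA gC.
Qed.

Lemma Ctensor_mapE (M N : cmod) (g : M -> N) v x : C_linear g ->
  Ctensor_map g (tens va (@cact M) v x) = tens va (@cact N) v (g x).
Proof. by move=> gl; apply: (tliftE (Ctensor_map_bal gl)). Qed.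

End Flatness.
End RingC.

Section RightModule.
Variables (R A : pzRingType) (f : {rmorphism R -> A}).
Local Notation Q := (Q f).

Lemma dQB n : zmod_morphism (@dQ R A f n).
Proof.
by case: n => [|[|n]] x y; [apply: rmorphB | apply: dAB | apply: st_dB].
Qed.

Lemma dQD n (x y : Q n) : dQ (x + y) = dQ x + dQ y.
Proof.
have d0 : dQ (0 : Q n) = 0 by rewrite -[X in dQ X](subrr 0) dQB subrr.
by rewrite -{1}[y]opprK dQB -[- y]sub0r dQB d0 sub0r opprK.
Qed.

Lemma QactDl n (x y : Q n) r : Qact (x + y) r = Qact x r + Qact y r.
Proof. by case: n x y => [|[|n]] x y; rewrite /= ?mulrDl ?rscaleDl. Qed.

Lemma QactDr n (x : Q n) r s : Qact x (r + s) = Qact x r + Qact x s.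
Proof.
by case: n x => [|[|n]] x; rewrite /= ?rmorphD ?mulrDr ?rscaleDr.
Qed.

Lemma QactA n (x : Q n) r s : Qact (Qact x r) s = Qact x (r * s).
Proof. by case: n x => [|[|n]] x; rewrite /= ?rmorphM ?mulrA ?rscaleA. Qed.

Lemma Qact1 n (x : Q n) : Qact x 1 = x.
Proof. by case: n x => [|[|n]] x; rewrite /= ?rmorph1 ?mulr1 ?rscale1. Qed.

Lemma Qact0l n r : Qact (0 : Q n) r = 0.
Proof. by apply: (addrI (Qact 0 r)); rewrite -QactDl !addr0. Qed.

Lemma Qact0r n (x : Q n) : Qact x 0 = 0.
Proof. by apply: (addrI (Qact x 0)); rewrite -QactDr !addr0. Qed.

Lemma QactBl n (x y : Q n) r : Qact (x - y) r = Qact x r - Qact y r.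
Proof. by apply/eqP; rewrite eq_sym subr_eq -QactDl subrK. Qed.

Lemma word_rscale a n r :
  rscale (word f a n) (f r) =
  word f (fun i => if i == n then a i * f r else a i) n.
Proof.
elim: n a => [|n IHn] a /=.
  by rewrite dAM dA_unit scaler0 addr0.
rewrite [LHS]rscale_btens IHn.
by congr btens; congr word.
Qed.

Lemma dQ_act n (x : Q n) r : dQ (Qact x r) = Qact (dQ x) r.
Proof.
case: n x => [|[|n]] x; first exact: rmorphM.
  by rewrite [LHS]dAM dA_unit scaler0 addr0.
elim/word_span: x => [x y hx hy|b a].
  by rewrite QactBl dQB hx hy -QactBl -dQB.
rewrite [Qact _ r in LHS]rscaleZ word_rscale !dQ_word [RHS]word_rscale.
by congr (word f _ n.+1); apply: functional_extensionality_dep => -[].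
Qed.

Lemma dQ_dQ n (x : Q n) : dQ (dQ x) = 0.
Proof.
case: n x => [|[|n]] x; [exact: dA_unit | exact: dK2_dA |].
elim/word_span: x => [x y hx hy|b a]; first by rewrite !dQB hx hy subr0.
by rewrite dQ_word; exact: (st_d_word f _ n.+1).
Qed.

Arguments Qact : simpl never.
Arguments dQ : simpl never.

Definition Qsum : zmodType := dsum Q.

(** [q (Σ a_n h_n + Σ b_n u_n)] has components [q_n a_n + ∂(q_{n-1}) b_{n-1}]. *)
Definition Qsum_comp (q : Qsum) (c : C R) (n : nat) : Q n :=
  match n with
  | 0 => Qact (q 0) (c.1 0)
  | m.+1 => Qact (q m.+1) (c.1 m.+1) + Qact (dQ (q m)) (c.2 m)
  end.

Lemma Qsum_comp_fin q c :
  exists N, forall n, (N <= n)%N -> Qsum_comp q c n = 0.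
Proof.
case: (dvalP c.1) (dvalP c.2) => N h [N' h']; exists (maxn N N').+1 => -[//|n].
rewrite ltnS geq_max => /andP[hN hN'] /=.
by rewrite h ?h' ?Qact0r ?addr0 // leqW.
Qed.

Definition Qsum_act (q : Qsum) (c : C R) : Qsum := Dsum (Qsum_comp_fin q c).

Lemma Qsum_actDl q q' c : Qsum_act (q + q') c = Qsum_act q c + Qsum_act q' c.
Proof.
apply: dsumP => -[|n]; first exact: QactDl.
by rewrite [RHS]addrACA -!QactDl -dQD.
Qed.

Lemma Qsum_actDr q c c' : Qsum_act q (c + c') = Qsum_act q c + Qsum_act q c'.
Proof.
apply: dsumP => -[|n]; first exact: QactDr.
by rewrite [RHS]addrACA -!QactDr.
Qed.

Lemma Qsum_actA q c c' : Qsum_act (Qsum_act q c) c' = Qsum_act q (Cmul c c').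
Proof.
apply: dsumP => -[|n] /=; first by rewrite QactA.
case: n => [|n] /=; rewrite QactDl QactDr !QactA -addrA; congr (_ + _).
  by rewrite dQ_act QactA addrC.
by rewrite dQD !dQ_act dQ_dQ Qact0l addr0 QactA addrC.
Qed.

Lemma Qsum_unital q : exists N (y : nat -> Qsum),
  q = \sum_(n < N) Qsum_act (y n) (Ch n (1 : R)).
Proof.
have [N hN] := dvalP q; exists N, (fun=> q); apply: dsumP => m.
have sE K : (\sum_(n < K) Qsum_act q (Ch n (1 : R))) m =
    \sum_(n < K) (Qsum_act q (Ch n (1 : R))) m.
  by elim: K => [|K IH]; rewrite ?big_ord0 // !big_ord_recr /= -IH.
have hE n : Qsum_act q (Ch n (1 : R)) m = if m == n then q m else 0.
  case: m {sE} => [|m] /=; case: eqP => _; rewrite ?Qact1 ?Qact0r ?addr0 //.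
rewrite sE (eq_bigr (fun n : 'I_N => if m == n then q m else 0)) => [|i _];
  last exact: hE.
case: (ltnP m N) => [mN|/hN ->]; last by rewrite big1 // => i _; case: eqP.
rewrite (bigD1 (Ordinal mN)) //= eqxx big1 ?addr0 // => i.
by rewrite -val_eqE /= eq_sym => /negPf->.
Qed.

Definition Qker n (q : Q n) : Prop := dQ q = 0.
Definition Qim n (q : Q n.+1) : Prop := exists p : Q n, dQ p = q.

Definition Q_exact : Prop :=
  injective (@dQ R A f 0) /\ forall n (q : Q n.+1), Qker q <-> Qim q.

Definition right_submodule n (U : Q n -> Prop) : Prop :=
  [/\ U 0, forall x y, U x -> U y -> U (x + y), forall x, U x -> U (- x)
    & forall x r, U x -> U (Qact x r)].

Definition internal_sum n (U W : Q n -> Prop) : Prop :=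
  (forall q, exists u w, [/\ U u, W w & q = u + w]) /\
  (forall q, U q -> W q -> q = 0).

(** Only degrees [m.+1 >= 1] are constrained. *)
Definition Q_split : Prop :=
  forall m, exists W : Q m.+1 -> Prop,
    [/\ right_submodule W, internal_sum (@Qim m) W
      & internal_sum (@Qker m.+1) W].

Definition trivial_extension : Prop :=
  exists t : A,
    [/\ t * t = 0, forall r, f r * t = t * f r,
        forall a, exists! p : R * R, a = f p.1 + f p.2 * t
      & forall a, exists! p : R * R, a = f p.1 + t * f p.2].

End RightModule.

Arguments Qact : simpl never.
Arguments dQ : simpl never.

(** If [R -> A] is onto then [Q_n = 0] for [n >= 2], and [Q_C] is not faithful:
    it kills the module [R] concentrated in degree [2]. This occurs
    for [A = R], whatever [R <> 0] is. *)
Section Surjective.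
Variable R : pzRingType.

Definition deg2_act (c : C R) (x : R) : R := c.1 2 * x.

Lemma deg2_unital (x : R) : exists N (y : nat -> R),
  x = \sum_(n < N) deg2_act (Ch n 1) (y n).
Proof.
exists 3, (fun=> x); rewrite !big_ord_recl big_ord0 /deg2_act /=.
by rewrite !mul0r !add0r mul1r addr0.
Qed.

Definition deg2 : cmod R.
Proof.
apply: (@Cmod R R deg2_act _ _ _ deg2_unital) => [c d x|c x y|c d x].
- exact: mulrDl.
- exact: mulrDr.
- by rewrite /deg2_act /= mulrA.
Defined.

Lemma surj_not_faithful (A : pzRingType) (f : {rmorphism R -> A}) :
    (1 : R) <> 0 -> (forall a, exists r, f r = a) ->
  ~ C_faithful (@Qsum_act R A f).
Proof.
move=> R1 fsurj ff; apply: R1; pose M := deg2.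
have K0 (z : K f) : z = 0.
  rewrite -(AAl_K z); elim/tens_ind: (K_val z) => [s t hs ht|x y].
    by rewrite AAlB hs ht subr0.
  by rewrite [AAl _]AAlE; have [r <-] := fsurj y; rewrite dA_unit scaler0.
have T0 q x : tens (@Qsum_act R A f) (@cact R M) q x = 0.
  have -> : x = cact (Ch 2 (1 : R)) (x : M).
    by rewrite /= /deg2_act /= mul1r.
  rewrite -tensA; have -> : Qsum_act q (Ch 2 (1 : R)) = 0; last exact: tens0l.
  by apply: dsumP => -[|[|[|n]]]; rewrite /= ?Qact0r ?addr0.
have idl : @C_linear R M M id by [].
have zl : @C_linear R M M (fun=> 0).
  by split=> [x y|d x]; rewrite ?subr0 // cact0r.
suff e : @Ctensor_map R _ (@Qsum_act R A f) M M id =1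
         @Ctensor_map R _ (@Qsum_act R A f) M M (fun=> 0).
  exact: (ff M M id (fun=> 0) idl zl e (1 : R)).
apply: tens_ext; [exact: (tliftB (Ctensor_map_bal _ idl)) |
  exact: (tliftB (Ctensor_map_bal _ zl)) |].
by move=> q x; rewrite !Ctensor_mapE // !T0.
Qed.

End Surjective.

Arguments lrestr {R A} f.
Arguments rrestr {R A} f.
Arguments Q_exact {R A} f.
Arguments Q_split {R A} f.
Arguments trivial_extension {R A} f.
Arguments Qsum_act {R A} f q c.

(* Main.v *)
(** Splitness and injectivity of [∂_0] give right [R]-linear maps
    [s_n : Q_(n+1) -> Q_n] contracting [Q] in all degrees: [s_0 ∂_0 = 1] and
    [s_(n+1) ∂_(n+1) + ∂_n s_n = 1]. Every right linear [σ : Q_(n+1) -> R] defines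
    a right [C]-linear map [q |-> σ(∂ q_n) h_n + σ(q_(n+1)) u_n] from [Q] to [C].
    Each [Q_n] is finitely generated projective over [R] on the right, because
    [A] is; composing the coordinates of [Q_n] in a dual basis with [s_n] thus
    yields coordinates of [Q] in a locally finite dual basis over [C], so that [Q]
    is projective, hence flat.

    For faithfulness it is enough that each [h_n] is a value of such a [C]-linear
    map. This follows from a right linear [φ : A -> R] with [φ 1 = 0] and
    [φ a = 1] for some [a]: contracting the first tensor factor with [φ] over and
    over gives [χ_n : Q_n -> R] which vanishes on [∂ Q_(n-1)] and takes the value
    [1], and then [σ = χ_n s_n] works. *)

From HB Require Import structures.
Require Import Defs.
From mathcomp Require Import all_boot all_algebra.
From mathcomp Require Import boolp.

Set Implicit Arguments.
Unset Strict Implicit.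
Unset Printing Implicit Defensive.

Import GRing.Theory.
Local Open Scope ring_scope.

Definition additive_of (V W : zmodType) (g : V -> W) (gB : zmod_morphism g) :
  {additive V -> W} := HB.pack g (GRing.isZmodMorphism.Build V W g gB).

Section DirectSumInjection.
Variable V : nat -> zmodType.

Definition dinj_val n (x : V n) m : V m :=
  if n =P m is ReflectT e then ecast i (V i) e x else 0.

Lemma dinj_val_id n (x : V n) : dinj_val x n = x.
Proof. by rewrite /dinj_val; case: eqP => // e; rewrite eq_axiomK. Qed.

Lemma dinj_val_neq n (x : V n) m : n != m -> dinj_val x m = 0.
Proof. by rewrite /dinj_val; case: eqP. Qed.

Lemma dinj_subproof n (x : V n) :
  exists N, forall m, (N <= m)%N -> dinj_val x m = 0.
Proof. by exists n.+1 => m nm; rewrite dinj_val_neq // ltn_eqF. Qed.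

Definition dinj n (x : V n) : dsum V := Dsum (dinj_subproof x).

Lemma dinjE n (x : V n) : dinj x n = x. Proof. exact: dinj_val_id. Qed.

Lemma dinj_neq n (x : V n) m : n != m -> dinj x m = 0.
Proof. exact: dinj_val_neq. Qed.

Lemma dinjB n : zmod_morphism (@dinj n).
Proof.
move=> x y; apply: dsumP => m; rewrite dvalB.
case: (eqVneq n m) => [<-|nm]; first by rewrite !dinjE.
by rewrite !dinj_neq ?subr0.
Qed.

HB.instance Definition _ n :=
  GRing.isZmodMorphism.Build (V n) (dsum V) (@dinj n) (@dinjB n).

Lemma dsum_expand (x : dsum V) K : (forall n, (K <= n)%N -> x n = 0) ->
  x = \sum_(n < K) dinj (x n).
Proof.
move=> x0; apply: dsumP => m.
have evB : zmod_morphism (fun y : dsum V => y m) by [].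
rewrite [RHS](raddf_sum (additive_of evB)) /=.
case: (ltnP m K) => [mK|Km]; last first.
  by rewrite x0 // big1 // => n _; rewrite dinj_val_neq // ltn_eqF // (leq_trans _ Km).
rewrite (bigD1 (Ordinal mK)) //= dinj_val_id big1 ?addr0 // => n.
by rewrite -val_eqE /= => nm; rewrite dinj_val_neq.
Qed.

End DirectSumInjection.
Arguments dinj : simpl never.

Lemma rscale0l (A : pzRingType) (V : bimodType A) a : rscale (0 : V) a = 0.
Proof. by apply: (addrI (rscale 0 a)); rewrite -rscaleDl !addr0. Qed.

Lemma rscaleNl (A : pzRingType) (V : bimodType A) (v : V) a :
  rscale (- v) a = - rscale v a.
Proof. by rewrite -[- v]sub0r rscaleBl rscale0l sub0r. Qed.

Section DualBasis.
Variable S : pzRingType.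

Record dual_basis (V : zmodType) (act : V -> S -> V) := DualBasis {
  db_ix : finType;
  db_vec : db_ix -> V;
  db_coord : db_ix -> {additive V -> S};
  db_coordZ : forall i v r, db_coord i (act v r) = db_coord i v * r;
  db_expand : forall v, v = \sum_i act (db_vec i) (db_coord i v)
}.

Lemma dual_basis_retract (I : finType) (V W : zmodType)
    (actV : V -> S -> V) (actW : W -> S -> W)
    (e : I -> {additive W -> V}) (p : I -> {additive V -> W}) :
    (forall i w r, e i (actW w r) = actV (e i w) r) ->
    (forall i v r, p i (actV v r) = actW (p i v) r) ->
    (forall v, v = \sum_i e i (p i v)) ->
  dual_basis actW -> dual_basis actV.
Proof.
move=> eZ pZ ep [J vec coord coordZ expand].
pose c (ij : I * J) : {additive V -> S} := coord ij.2 \o p ij.1.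
apply: (@DualBasis _ _ _ (fun ij => e ij.1 (vec ij.2)) c) => [ij v r|v].
  by rewrite /= pZ coordZ.
rewrite {1}[v]ep -(pair_bigA _ (fun i j => actV (e i (vec j)) (c (i, j) v))) /=.
apply: eq_bigr => i _; rewrite {1}[p i v]expand raddf_sum.
by apply: eq_bigr => j _; rewrite eZ.
Qed.

End DualBasis.

Arguments db_vec {S V act}.
Arguments db_coord {S V act}.
Arguments db_coordZ {S V act}.
Arguments db_expand {S V act}.

Section RightBases.
Variables (R A : pzRingType) (f : {rmorphism R -> A}).

Lemma rrestr_dual_basis : fin_gen (rrestr f) -> projective (rrestr f) ->
  dual_basis (@Qact R A f 1).
Proof.
move=> /cid[n /cid[e gen]] proj.
pose N : lmodType R^c := {ffun 'I_n -> (R^c)^o}.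
pose g (c : N) : rrestr f := \sum_i (c i : R^c) *: e i.
have gL : linear g.
  move=> r x y; rewrite /g scaler_sumr -big_split /=; apply: eq_bigr => i _.
  by rewrite !ffunE scalerDl scalerA.
pose gl : {linear N -> rrestr f} :=
  HB.pack g (GRing.isLinear.Build R^c N (rrestr f) *:%R g gL).
have /cid[l lE] : exists l : {linear rrestr f -> N}, gl \o l =1 idfun.
  apply: proj => y; have [c ->] := gen y; exists [ffun i => c i].
  by apply: eq_bigr => i _; rewrite ffunE.
have cB i : zmod_morphism (fun a : A => l a i : R).
  by move=> x y; rewrite raddfB !ffunE.
apply: (@DualBasis _ _ _ _ e (fun i => additive_of (cB i))) => [i v r|v].
  by rewrite /= (linearZ_LR l (r : R^c) (v : rrestr f)) ffunE.
exact/esym/lE.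
Qed.

Section Contraction.
Variable phi : {additive A -> R}.
Hypothesis phiZ : forall a r, phi (a * f r) = phi a * r.

(** [φ ⊗ A : A ⊗_R A -> R ⊗_R A = A]. *)
Definition AAcontr : AA f -> A := tlift (fun x y : A => f (phi x) * y).

Lemma AAcontr_bal : balanced (fun (x : A) (r : R) => x * f r)
  (fun (r : R) (y : A) => f r * y) (fun x y : A => f (phi x) * y).
Proof.
split=> [x x' y|x y y'|x r y]; first by rewrite !raddfD mulrDl.
  by rewrite mulrDr.
by rewrite phiZ rmorphM mulrA.
Qed.

Lemma AAcontrB : zmod_morphism AAcontr.
Proof. exact: tliftB AAcontr_bal. Qed.

Lemma AAcontrE x y : AAcontr (AAtens f x y) = f (phi x) * y.
Proof. exact: tliftE AAcontr_bal x y. Qed.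

Definition Kcontr (z : K f) : A := AAcontr (K_val z).

Lemma KcontrB : zmod_morphism Kcontr.
Proof. by move=> z w; rewrite /Kcontr K_valB AAcontrB. Qed.

HB.instance Definition _ := GRing.isZmodMorphism.Build (K f) A Kcontr KcontrB.

Lemma Kcontr_rscale z a : Kcontr (rscale z a) = Kcontr z * a.
Proof.
rewrite /Kcontr K_val_rscale; move: (K_val z); apply: AA_ext => [x y|x y|x y].
- by rewrite rscaleBl AAcontrB.
- by rewrite AAcontrB mulrBl.
- by rewrite rscale_AAtens !AAcontrE mulrA.
Qed.

Lemma Kcontr_dA a : Kcontr (dA f a) = f (phi 1) * a - f (phi a).
Proof. by rewrite /Kcontr AAcontrB !AAcontrE mulr1. Qed.

Section Tensor.
Variable V : bimodType A.

Lemma bcontr_bal : balanced (@rscale A (K f)) (fun (a : A) (v : V) => a *: v)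
  (fun z v => Kcontr z *: v).
Proof.
split=> [z z' v|z v v'|z a v]; first by rewrite raddfD scalerDl.
  by rewrite scalerDr.
by rewrite Kcontr_rscale scalerA.
Qed.

Definition bcontr : btensor (K f) V -> V := tlift (fun z v => Kcontr z *: v).

Lemma bcontrB : zmod_morphism bcontr.
Proof. exact: tliftB bcontr_bal. Qed.

HB.instance Definition _ := GRing.isZmodMorphism.Build _ V bcontr bcontrB.

Lemma bcontrE z v : bcontr (btens z v) = Kcontr z *: v.
Proof. exact: tliftE bcontr_bal z v. Qed.

Lemma bcontr_rscale x a : bcontr (rscale x a) = rscale (bcontr x) a.
Proof.
move: x; apply: btens_ext => [x y|x y|z v].
- by rewrite rscaleBl bcontrB.
- by rewrite bcontrB rscaleBl.
- by rewrite rscale_btens !bcontrE rscaleZ.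
Qed.

End Tensor.
End Contraction.

Section QDualBasis.
Variable bA : dual_basis (@Qact R A f 1).

Let coordZ i a r : db_coord bA i (a * f r) = db_coord bA i a * r.
Proof. exact: db_coordZ bA i a r. Qed.

(** The sign is that of [AAr_K]: [Σ x ⊗ y = - Σ ∂x y] on [K]. *)
Let vecK i : K f := - dA f (db_vec bA i).

Lemma K_expand z : z = \sum_i rscale (vecK i) (Kcontr (db_coord bA i) z).
Proof.
apply: oppr_inj; rewrite -[LHS]AAr_K /Kcontr.
move: (K_val z); apply: AA_ext => [x y|x y|x y]; first exact: AArB.
  rewrite -opprD -sumrB; congr (- _); apply: eq_bigr => i _.
  by rewrite AAcontrB // rscaleBr.
have dAZ v r : dA f (@Qact R A f 1 v r) = rscale (dA f v) (f r).
  exact: (dA_rl f v r 0).1.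
rewrite AArE {1}[x](db_expand bA) (big_morph _ (@dAD R A f) (@dA0 R A f)).
rewrite (big_morph (fun z : K f => rscale z y)
  (fun z w => rscaleDl z w y) (rscale0l _ y)).
rewrite -sumrN; apply: eq_bigr => i _.
by rewrite AAcontrE // dAZ rscaleA /vecK rscaleNl opprK.
Qed.

Lemma K_dual_basis : dual_basis (fun (z : K f) r => rscale z (f r)).
Proof.
have eB i : zmod_morphism (rscale (vecK i)).
  by move=> x y; rewrite rscaleBr.
apply: (@dual_basis_retract R _ (K f) (Q f 1) _ (@Qact R A f 1)
    (fun i => additive_of (eB i))
    (fun i => additive_of (KcontrB (coordZ i)))) bA => [i w r|i v r|v] /=.
- by rewrite rscaleA.
- exact: Kcontr_rscale.
- exact: K_expand.
Qed.

Lemma btensor_dual_basis (V : bimodType A) :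
    dual_basis (fun (v : V) r => rscale v (f r)) ->
  dual_basis (fun (x : btensor (K f) V) r => rscale x (f r)).
Proof.
have eB i : zmod_morphism (btens (vecK i) : V -> btensor (K f) V).
  by move=> x y; rewrite btensBr.
apply: (dual_basis_retract (e := fun i => additive_of (eB i))
   (p := fun i => additive_of (@bcontrB _ (coordZ i) V))) => [i w r|i v r|] /=.
- by rewrite rscale_btens.
- exact: bcontr_rscale.
apply: btens_ext => [x y //|x y|z v].
  by rewrite -sumrB; apply: eq_bigr => i _; rewrite bcontrB // btensBr.
rewrite {1}[z]K_expand (big_morph (fun z => btens z v)
  (fun x y => btensDl x y v) (btens0l _ v)).
by apply: eq_bigr => i _; rewrite bcontrE // btensA.
Qed.

Lemma Q_dual_basis n : dual_basis (@Qact R A f n).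
Proof.
case: n => [|[//|n]].
  apply: (@DualBasis _ _ _ unit (fun=> 1) (fun=> idfun)) => [//|v].
  by rewrite big_const card_unit /= addr0 [RHS]mul1r.
elim: n => [|n IHn]; first exact: K_dual_basis.
exact: btensor_dual_basis IHn.
Qed.

End QDualBasis.
End RightBases.

Section RightCModule.
Variables (R : pzRingType) (V : zmodType) (va : V -> C R -> V).
Local Notation Tmap g := (@Ctensor_map R V va _ _ g).

Section Coordinate.
Variable theta : {additive V -> C R}.
Hypothesis thetaA : forall v c, theta (va v c) = Cmul (theta v) c.

Lemma Ccoord_bal (M : cmod R) :
  balanced va (@cact R M) (fun v (x : M) => cact (theta v) x).
Proof.
split=> [v w x|v x y|v c x]; first by rewrite raddfD cactDl.
  exact: cactDr.
by rewrite thetaA cactA.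
Qed.

Definition Ccoord (M : cmod R) : Ctensor va M -> M :=
  tlift (fun v x => cact (theta v) x).

Lemma CcoordE (M : cmod R) v (x : M) :
  Ccoord (tens va (@cact R M) v x) = cact (theta v) x.
Proof. exact: tliftE (Ccoord_bal M) v x. Qed.

Lemma CcoordB (M : cmod R) : zmod_morphism (@Ccoord M).
Proof. exact: tliftB (Ccoord_bal M). Qed.

Lemma Ccoord_map (M N : cmod R) (g : M -> N) : C_linear g ->
  forall x, Ccoord (Tmap g x) = g (Ccoord x).
Proof.
move=> gl; have [gB gC] := gl.
have mB : zmod_morphism (Tmap g) := tliftB (Ctensor_map_bal va gl).
apply: tens_ext => [x y|x y|v x].
- by rewrite mB CcoordB.
- by rewrite CcoordB gB.
- by rewrite Ctensor_mapE // !CcoordE gC.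
Qed.

End Coordinate.

Lemma C_flat_of_dual_basis (J : nat -> finType) (eps : forall n, J n -> V)
    (theta : forall n, J n -> {additive V -> C R}) :
    (forall n j v c, theta n j (va v c) = Cmul (theta n j v) c) ->
    (forall v, exists N, forall K, (N <= K)%N ->
       v = \sum_(n < K) \sum_j va (eps n j) (theta n j v)) ->
  C_flat va.
Proof.
move=> thetaA expand.
have texpand (M : cmod R) (t : Ctensor va M) : exists K, t = \sum_(n < K) \sum_j
    tens va (@cact R M) (eps n j) (Ccoord (theta n j) t).
  suff [N hN] : exists N, forall K, (N <= K)%N -> t = \sum_(n < K) \sum_j
      tens va (@cact R M) (eps n j) (Ccoord (theta n j) t).
    by exists N; apply: hN.
  elim/tens_ind: t => [x y [N hN] [N' hN']|v x].
    exists (maxn N N') => K; rewrite geq_max => /andP[hK hK'].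
    rewrite {1}[x](hN K) // {1}[y](hN' K) // -sumrB.
    apply: eq_bigr => n _; rewrite -sumrB.
    by apply: eq_bigr => j _; rewrite (CcoordB (thetaA n j)) tensBr.
  have [N hN] := expand v; exists N => K hK.
  have tensl := big_morph (fun v => tens va (@cact R M) v x)
    (fun v w => tensDl va (@cact R M) v w x) (tens0l va (@cact R M) x).
  rewrite {1}[v](hN K) // tensl; apply: eq_bigr => n _.
  rewrite tensl; apply: eq_bigr => j _.
  by rewrite (CcoordE (thetaA n j)) tensA.
move=> M N P i p il pl [i_inj ip p_surj]; have [pB pC] := pl; have [iB _] := il.
have iTB : zmod_morphism (Tmap i) := tliftB (Ctensor_map_bal va il).
have pTB : zmod_morphism (Tmap p) := tliftB (Ctensor_map_bal va pl).
have p0 : p 0 = 0 by rewrite -(subrr 0) pB subrr.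
have pi0 x : p (i x) = 0 by apply/ip; exists x.
split=> [x y exy|y|z].
- have [K xK] := texpand M (x - y).
  apply/eqP; rewrite -subr_eq0 xK; apply/eqP.
  apply: big1 => n _; apply: big1 => j _; rewrite (CcoordB (thetaA n j)).
  suff -> : Ccoord (theta n j) x = Ccoord (theta n j) y by rewrite subrr tens0r.
  by apply: i_inj; rewrite -!(Ccoord_map (thetaA n j)) // exy.
- split=> [y0|[x <-]]; last first.
    elim/tens_ind: x => [x x' hx hx'|v x].
      by rewrite iTB pTB hx hx' subrr.
    by rewrite !Ctensor_mapE // pi0 tens0r.
  have lft n j : exists x, i x = Ccoord (theta n j) y.
    by apply/ip; rewrite -(Ccoord_map (thetaA n j)) // y0 -(subrr 0)
      (CcoordB (thetaA n j)) subrr.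
  have [K ->] := texpand N y.
  have iTD : {morph Tmap i : x x' / x + x'} := tliftD (Ctensor_map_bal va il).
  have iT0 : Tmap i 0 = 0 by rewrite -(subrr 0) iTB subrr.
  have im_sum (I : finType) (F : I -> Ctensor va N) :
    (forall k, exists x, Tmap i x = F k) ->
    exists x, Tmap i x = \sum_k F k.
    move=> /choice[G GF]; exists (\sum_k G k).
    by rewrite (big_morph _ iTD iT0); apply: eq_bigr.
  apply: (im_sum) => n; apply: (im_sum) => j; have [x <-] := lft n j.
  by exists (tens va (@cact R M) (eps n j) x); rewrite Ctensor_mapE.
- elim/tens_ind: z => [z z' [y <-] [y' <-]|v z]; first by exists (y - y'); rewrite pTB.
  have [y <-] := p_surj z.
  by exists (tens va (@cact R N) v y); rewrite Ctensor_mapE.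
Qed.

Lemma C_faithful_of_coord :
    (forall n, exists2 theta : {additive V -> C R},
      forall v c, theta (va v c) = Cmul (theta v) c
      & exists v, theta v = Ch n 1) ->
  C_faithful va.
Proof.
move=> coord M N g h gl hl egh x; have [gB gC] := gl; have [hB hC] := hl.
have [K [y ->]] := cact_unital x.
have sum_of (k : M -> N) (kB : zmod_morphism k) (F : 'I_K -> M) :
    k (\sum_n F n) = \sum_n k (F n).
  exact: (raddf_sum (additive_of kB)).
rewrite !sum_of //; apply: eq_bigr => n _.
have [theta thetaA [v <-]] := coord n.
rewrite gC hC -!(CcoordE thetaA); congr Ccoord.
by rewrite -!(Ctensor_mapE va) // egh.
Qed.

End RightCModule.

Section UniversalComplex.
Variables (R A : pzRingType) (f : {rmorphism R -> A}).

Lemma dQ0 n : dQ (0 : Q f n) = 0.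
Proof. exact: raddf0 (additive_of (@dQB R A f n)). Qed.

Lemma dQ_sum n (I : finType) (F : I -> Q f n) :
  dQ (\sum_i F i) = \sum_i dQ (F i).
Proof. exact: raddf_sum (additive_of (@dQB R A f n)) _ _ _ _. Qed.

Definition contracting_homotopy (s : forall n, {additive Q f n.+1 -> Q f n}) :=
  [/\ forall n q r, s n (Qact q r) = Qact (s n q) r,
      forall q : Q f 0, s 0%N (dQ q) = q
    & forall n (q : Q f n.+1), s n.+1 (dQ q) + dQ (s n q) = q].

Lemma split_contracting_homotopy : injective (@dQ R A f 0) -> Q_split f ->
  exists s, contracting_homotopy s.
Proof.
move=> inj0 split.
pose W n : Q f n -> Prop :=
  if n is m.+1 return Q f n -> Prop then sval (cid (split m)) else fun=> True.
have Wsub n : right_submodule (@W n).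
  by case: n => [//|m]; rewrite /W; case: cid => ? /= [].
have WB n (x y : Q f n) : W n x -> W n y -> W n (x - y).
  by have [_ WD WN _] := Wsub n => hx hy; apply: WD => //; apply: WN.
have Wker n (x : Q f n) : W n x -> dQ x = 0 -> x = 0.
  case: n x => [x _ dx|m x]; first by apply: inj0; rewrite dx dQ0.
  by rewrite /W; case: cid => ? /= [_ _ [_ h]] hW hK; apply: h.
have Wim n (x : Q f n.+1) : W n.+1 x -> Qim x -> x = 0.
  by rewrite /W; case: cid => ? /= [_ [_ h] _] hW hI; apply: h.
have Wlift n (x : Q f n) : exists2 p, W n p & dQ p = dQ x.
  case: n x => [x|m x]; first by exists x.
  rewrite /W; case: cid => U /= [_ _ [/(_ x)[u [w [hu hw ->]]] _]].
  by exists w => //; rewrite dQD hu add0r.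
have key n (q : Q f n.+1) : exists p, W n p /\ W n.+1 (q - dQ p).
  have [p hp] : exists p : Q f n, W n.+1 (q - dQ p).
    rewrite {1}/W; case: cid => U /= [_ [/(_ q)[u [w [[p <-] hw ->]]] _] _].
    by exists p; rewrite addrC addKr.
  by have [p' hp' e] := Wlift n p; exists p'; rewrite e.
have uniq n (q : Q f n.+1) p p' : W n p -> W n.+1 (q - dQ p) ->
    W n p' -> W n.+1 (q - dQ p') -> p = p'.
  move=> hp hq hp' hq'; apply/eqP; rewrite -subr_eq0; apply/eqP.
  apply: Wker; first exact: WB.
  apply: Wim; last by exists (p - p').
  have := WB _ _ _ hq' hq; rewrite dQB opprB [_ + (dQ p - q)]addrC.
  by rewrite addrA subrK.
pose s n q := sval (cid (key n q)).
have sP n q : W n (s n q) /\ W n.+1 (q - dQ (s n q)) by rewrite /s; case: cid.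
have sE n q p : W n p -> W n.+1 (q - dQ p) -> s n q = p.
  by have [h h'] := sP n q => hp hq; apply: uniq hq.
have sB n : zmod_morphism (s n).
  move=> x y; have [hx hx'] := sP n x; have [hy hy'] := sP n y.
  apply: sE; first exact: WB.
  by rewrite dQB opprD addrACA -opprD; apply: WB.
exists (fun n => additive_of (sB n)); split=> [n q r|q|n q] /=.
- have [h h'] := sP n q; have [_ _ _ WZ] := Wsub n.
  apply: sE; first exact: WZ.
  by rewrite dQ_act -QactBl; have [_ _ _ WZ'] := Wsub n.+1; apply: WZ'.
- by apply: (sE 0) => //; rewrite subrr; case: (Wsub 1).
- have [h h'] := sP n q; rewrite (sE _ _ (q - dQ (s n q))) ?subrK //.
  by rewrite dQB dQ_dQ subr0 subrr; case: (Wsub n.+2).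
Qed.

Lemma dQ_Qsum_act (q : Qsum f) c n :
  dQ (Qsum_act f q c n) = dQ (Qact (q n) (c.1 n)).
Proof.
case: n => [//|n]; rewrite [Qsum_act _ _ _ _]/(_ + _) dQD.
by rewrite (dQ_act (dQ _)) dQ_dQ Qact0l addr0.
Qed.

Section Coordinate.
Variables (n : nat) (sigma : {additive Q f n.+1 -> R}).
Hypothesis sigmaZ : forall q r, sigma (Qact q r) = sigma q * r.

Definition Qcoord (q : Qsum f) : C R :=
  Ch n (sigma (dQ (q n))) + Cu n (sigma (q n.+1)).

Lemma Qcoord1E q m :
  (Qcoord q).1 m = if m == n then sigma (dQ (q n)) else 0.
Proof. by rewrite [LHS]addr0. Qed.

Lemma Qcoord2E q m : (Qcoord q).2 m = if m == n then sigma (q n.+1) else 0.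
Proof. by rewrite [LHS]add0r. Qed.

Lemma QcoordB : zmod_morphism Qcoord.
Proof.
move=> p q; apply: CP => m.
  have -> : (Qcoord p - Qcoord q).1 m = (Qcoord p).1 m - (Qcoord q).1 m by [].
  rewrite !Qcoord1E; case: eqP => _; last by rewrite subr0.
  by rewrite dvalB dQB raddfB.
have -> : (Qcoord p - Qcoord q).2 m = (Qcoord p).2 m - (Qcoord q).2 m by [].
  rewrite !Qcoord2E; case: eqP => _; last by rewrite subr0.
by rewrite dvalB raddfB.
Qed.

Lemma Qcoord_act q c : Qcoord (Qsum_act f q c) = Cmul (Qcoord q) c.
Proof.
apply: CP => m.
  have -> : (Cmul (Qcoord q) c).1 m = (Qcoord q).1 m * c.1 m by [].
  rewrite !Qcoord1E; case: eqP => [->|_]; last by rewrite mul0r.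
  by rewrite -sigmaZ -dQ_act dQ_Qsum_act.
have -> : (Cmul (Qcoord q) c).2 m =
  (Qcoord q).1 m * c.2 m + (Qcoord q).2 m * c.1 m.+1 by [].
rewrite Qcoord1E !Qcoord2E; case: eqP => [->|_]; last by rewrite !mul0r addr0.
by rewrite -!sigmaZ -raddfD addrC.
Qed.
End Coordinate.

Lemma Qsum_act_dinj n (x : Q f n) a b :
  Qsum_act f (dinj x) (Ch n a + Cu n b) =
  dinj (Qact x a) + dinj (Qact (dQ x) b).
Proof.
have c1 m : (Ch n a + Cu n b).1 m = if m == n then a else 0 by exact: addr0.
have c2 m : (Ch n a + Cu n b).2 m = if m == n then b else 0 by exact: add0r.
have first m : Qact (dinj x m) ((Ch n a + Cu n b).1 m) = dinj (Qact x a) m.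
  rewrite c1; case: (eqVneq m n) => [->|mn]; first by rewrite !dinjE.
  by rewrite Qact0r dinj_neq // eq_sym.
apply: dsumP => -[|m]; rewrite dvalD -first; first by rewrite (dinj_neq (Qact (dQ x) b)) ?addr0.
rewrite [LHS]/(_ + _) c2; congr (_ + _).
case: (eqVneq m n) => [->|mn]; first by rewrite !dinjE.
by rewrite Qact0r dinj_neq // eqSS eq_sym.
Qed.

Variables (s : forall n, {additive Q f n.+1 -> Q f n}).
Hypothesis s_homotopy : contracting_homotopy s.

Lemma dQ_s_dQ n (q : Q f n) : dQ (s n (dQ q)) = dQ q.
Proof.
have [_ s0 sS] := s_homotopy.
case: n q => [|n] q; first by rewrite s0.
by rewrite -{2}[q]sS dQD dQ_dQ addr0.
Qed.

Lemma homotopy_expand (q : Qsum f) K : (forall n, (K <= n)%N -> q n = 0) ->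
  q = \sum_(n < K) (dinj (s n (dQ (q n))) + dinj (dQ (s n (q n.+1)))).
Proof.
have [_ s0 sS] := s_homotopy => q0; rewrite {1}(dsum_expand q0).
suff -> : \sum_(n < K) (dinj (s n (dQ (q n))) + dinj (dQ (s n (q n.+1)))) =
    \sum_(n < K) dinj (q n) + dinj (q K - s K (dQ (q K))).
  by rewrite q0 // dQ0 raddf0 subr0 raddf0 addr0.
elim: {q0} K => [|K IH]; first by rewrite !big_ord0 add0r s0 subrr raddf0.
rewrite !big_ord_recr /= IH -!addrA; congr (_ + _).
rewrite addrA -raddfD subrK; congr (_ + dinj _).
by rewrite -{2}[q K.+1]sS addrC addKr.
Qed.

Lemma Q_flat : dual_basis (@Qact R A f 1) -> C_flat (Qsum_act f).
Proof.
move=> bA; pose b n := Q_dual_basis bA n; have [sZ _ _] := s_homotopy.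
pose sigma n j : {additive Q f n.+1 -> R} := db_coord (b n) j \o s n.
have sigmaZ n j q r : sigma n j (Qact q r) = sigma n j q * r.
  by rewrite /= sZ db_coordZ.
apply: (@C_flat_of_dual_basis _ _ _ (fun n => db_ix (b n))
    (fun n j => dinj (s n (dQ (db_vec (b n) j))))
    (fun n j => additive_of (QcoordB (sigma n j)))) => [n j v c|q].
  exact: Qcoord_act.
have [N hN] := dvalP q; exists N => K NK.
rewrite {1}(@homotopy_expand q K); last first.
  by move=> n Kn; apply: hN; apply: leq_trans Kn.
apply: eq_bigr => n _ /=.
rewrite (eq_bigr _ (fun j _ => Qsum_act_dinj _ _ _)) big_split /=.
rewrite -!(raddf_sum (@dinj (Q f) _)).
congr (_ + _); congr dinj.
  rewrite -[in LHS]dQ_s_dQ {1}[s n (dQ (q n))](db_expand (b n)).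
  rewrite dQ_sum raddf_sum /=; apply: eq_bigr => j _.
  by rewrite dQ_act sZ.
rewrite {1}[s n (q n.+1)](db_expand (b n)) dQ_sum.
by apply: eq_bigr => j _; rewrite dQ_act dQ_s_dQ.
Qed.

Lemma word_lscale r a n :
  f r *: word f a n = word f (fun i => if i == 0 then f r * a i else a i) n.
Proof.
case: n => [|n]; first by rewrite /= (dA_rl f 0 r (a 0)).2.
by rewrite [LHS]scale_btens -(dA_rl f 0 r (a 0)).2.
Qed.

Section Faithful.
Variables (phi : {additive A -> R}) (a : A).
Hypotheses (phiZ : forall x r, phi (x * f r) = phi x * r)
  (phi1 : phi 1 = 0) (phia : phi a = 1).

Lemma Kcontr_dA1 x : Kcontr phi (dA f x) = f (- phi x).
Proof. by rewrite (Kcontr_dA phiZ) phi1 rmorph0 mul0r sub0r rmorphN. Qed.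

Lemma phif r : phi (f r) = 0.
Proof. by rewrite -[f r]mul1r phiZ phi1 mul0r. Qed.

Lemma stages_functional n : exists chi : {additive stages f n -> R},
  [/\ forall v r, chi (rscale v (f r)) = chi v * r,
      forall w, chi (word f w n) = 0 & exists v, chi v = 1].
Proof.
elim: n => [|n [chi [chiZ chi_word [v chiv]]]].
  exists (phi \o additive_of (KcontrB phiZ)); split=> [v r|w|] /=.
  - by rewrite (Kcontr_rscale phiZ) phiZ.
  - by rewrite Kcontr_dA1 phif.
  - exists (rscale (- dA f a) a).
    rewrite (Kcontr_rscale phiZ) (raddfN (additive_of (KcontrB phiZ))) /=.
    by rewrite Kcontr_dA1 phia rmorphN opprK rmorph1 mul1r.
exists (chi \o additive_of (@bcontrB _ _ _ _ phiZ (stages f n))).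
split=> [x r|w|] /=.
- by rewrite (bcontr_rscale phiZ) chiZ.
- by rewrite (bcontrE phiZ) Kcontr_dA1 word_lscale chi_word.
- exists (btens (- dA f a) v); rewrite (bcontrE phiZ).
  rewrite (raddfN (additive_of (KcontrB phiZ))) /=.
  by rewrite Kcontr_dA1 phia rmorphN opprK rmorph1 scale1r.
Qed.

Lemma Q_functional n : exists chi : {additive Q f n -> R},
  (forall q r, chi (Qact q r) = chi q * r) /\
  exists q, chi (s n (dQ q)) = 1.
Proof.
have [_ s0 sS] := s_homotopy.
have homotopy_unit m (chi : {additive Q f m.+1 -> R}) :
    (forall p : Q f m, chi (dQ p) = 0) ->
    forall q, chi (s m.+1 (dQ q)) = chi q.
  by move=> chi0 q; rewrite -[q in RHS]sS raddfD chi0 addr0.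
case: n => [|[|n]].
- by exists idfun; split=> //; exists 1; rewrite s0.
- exists phi; split; first exact: phiZ.
  by exists a; rewrite homotopy_unit //; apply: phif.
have [chi [chiZ chi_word [v chiv]]] := stages_functional n.
exists chi; split; first exact: chiZ.
exists v; rewrite (homotopy_unit n.+1) //; case: n chi {chiZ v chiv} chi_word
  => [|n] chi chi_word p; first exact: chi_word (fun=> p).
elim/word_span: p => [x y hx hy|b w]; first by rewrite dQB raddfB hx hy subrr.
by rewrite dQ_word chi_word.
Qed.

Lemma Q_faithful : C_faithful (Qsum_act f).
Proof.
have [sZ _ _] := s_homotopy.
apply: C_faithful_of_coord => n; have [chi [chiZ [q chiq]]] := Q_functional n.
pose sigma : {additive Q f n.+1 -> R} := chi \o s n.
have sigmaZ p r : sigma (Qact p r) = sigma p * r by rewrite /= sZ chiZ.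
exists (additive_of (QcoordB sigma)); first exact: Qcoord_act.
exists (dinj q).
have -> : additive_of (QcoordB sigma) (dinj q) =
  Ch n (sigma (dQ (dinj q n))) + Cu n (sigma (dinj q n.+1)) by [].
rewrite dinjE dinj_neq ?neq_ltn ?ltnSn // raddf0 /= chiq.
apply: CP => m; first exact: addr0.
by rewrite [LHS]add0r /=; case: eqP.
Qed.

End Faithful.

Lemma trivial_extension_functional : trivial_extension f ->
  exists (phi : {additive A -> R}) (a : A),
    [/\ forall x r, phi (x * f r) = phi x * r, phi 1 = 0 & phi a = 1].
Proof.
case=> t [_ _ _ right_coord].
pose c a := sval (cid (right_coord a)).
have cP a : a = f (c a).1 + t * f (c a).2 by rewrite /c; case: cid => ? /= [].
have cE a p : a = f p.1 + t * f p.2 -> c a = p.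
  have [u [_ uniq]] := right_coord a.
  by move=> /uniq <-; apply/esym/uniq/cP.
have phiB : zmod_morphism (fun a => (c a).2).
  move=> x y; rewrite (cE _ (c x - c y)) //= !rmorphB mulrBr addrACA -opprD.
  by rewrite -!cP.
exists (additive_of phiB), t; split=> [x r||] /=.
- rewrite (cE _ ((c x).1 * r, (c x).2 * r)) //= !rmorphM mulrA -mulrDl.
  by rewrite -cP.
- by rewrite (cE _ (1, 0)) //= rmorph1 rmorph0 mulr0 addr0.
- by rewrite (cE _ (0, 1)) //= rmorph1 rmorph0 mulr1 add0r.
Qed.

Lemma division_ring_functional :
    dual_basis (@Qact R A f 1) ->
    division_ring R -> ~ (forall a, exists r, f r = a) ->
  exists (phi : {additive A -> R}) (a : A),
    [/\ forall x r, phi (x * f r) = phi x * r, phi 1 = 0 & phi a = 1].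
Proof.
have [sZ s0 _] := s_homotopy; move=> b [_ Rinv] /existsNP[a a_notin].
pose p (x : A) : A := x - f (s 0 x).
have pB : zmod_morphism p.
  by move=> x y; rewrite /p raddfB rmorphB !opprD addrACA.
have pZ x r : p (x * f r) = p x * f r.
  by rewrite /p (sZ 0 x r) rmorphM mulrBl.
have s1 : s 0 (1 : A) = (1 : R).
  by have := s0 (1 : R); rewrite /dQ rmorph1.
have p1 : p 1 = 0 by rewrite /p s1 rmorph1 subrr.
have pa : p a <> 0.
  by move=> /eqP; rewrite subr_eq0 => /eqP e; apply: a_notin; exists (s 0 a).
have [j phija] : exists j, db_coord b j (p a) <> 0.
  apply/existsNP => coord0; apply: pa; rewrite (db_expand b (p a)).
  by apply: big1 => j _; rewrite coord0 Qact0r.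
have [c _ cphi] := Rinv _ phija.
have phiB : zmod_morphism (fun x => c * db_coord b j (p x)).
  by move=> x y; rewrite pB raddfB mulrBr.
exists (additive_of phiB), a; split=> [x r||//] /=.
- by rewrite pZ -mulrA -(db_coordZ b).
- by rewrite p1 raddf0 mulr0.
Qed.

End UniversalComplex.

Theorem theoremC (k : comPzRingType) (R A : algType k) (f : {lrmorphism R -> A})
    (A_left_fg : fin_gen (lrestr f)) (A_left_proj : projective (lrestr f))
    (A_right_fg : fin_gen (rrestr f)) (A_right_proj : projective (rrestr f))
    (Q_is_exact : Q_exact f) (Q_splits : Q_split f) :
  [/\ C_flat (Qsum_act f),
      trivial_extension f -> C_faithfully_flat (Qsum_act f)
    & division_ring k -> division_ring R -> ~ bijective f ->
      C_faithfully_flat (Qsum_act f)].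
Proof.
have [inj0 _] := Q_is_exact.
have [s s_homotopy] := split_contracting_homotopy inj0 Q_splits.
have b := rrestr_dual_basis A_right_fg A_right_proj.
have flat := Q_flat s_homotopy b.
split=> // [/trivial_extension_functional|_ Rdiv f_nbij].
  by case=> phi [a [phiZ phi1 phia]]; split=> //; exact: (Q_faithful s_homotopy phiZ phi1 phia).
have f_nsurj : ~ (forall a, exists r, f r = a).
  move=> /choice[g gK]; apply: f_nbij; exists g => // r.
  by apply: inj0; apply: gK.
have [phi [a [phiZ phi1 phia]]] :=
  division_ring_functional s_homotopy b Rdiv f_nsurj.
by split=> //; exact: (Q_faithful s_homotopy phiZ phi1 phia).
Qed.
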